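(* Let $0\leq\alpha\leq 1/4$. Let $A=\{a_1<a_2<\cdots\}$ and $B=\{b_1<b_2<\cdots\}$ be two infinite subsets of $\mathbb{N}$ such that (1) $a_i-b_i=o\big(a_i^{\frac12-\alpha}\big)$ as $i\to+\infty$; (2) $A(n)-B(n)=O(n^{\alpha})$ for all $n\geq 1$. Then there is no constant $c>0$ for which $$R_{A,B}(n)=cn+o\big(n^{\frac14}\big)\qquad\text{as } n\to\infty .$$
   Context: $\mathbb{N}$ denotes the set of nonnegative integers. For a set $A\subseteq\mathbb{N}$ and $n\in\mathbb{N}$, $A(n)=|\{a\in A: a\leq n\}|$ (and similarly $B(n)$). For $A,B\subseteq\mathbb{N}$, $R_{A,B}(n)=|\{(a,b): a\in A,\ b\in B,\ a+b\leq n\}|$. The elements of infinite sets are listed in increasing order, so $a_i$ (resp. $b_i$) is the $i$-th smallest element of $A$ (resp. $B$). *)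

(* Defs.v *)
From HB Require Import structures.
From mathcomp Require Import all_boot all_order all_algebra.
From mathcomp Require Import finmap.
From mathcomp Require Import all_classical all_reals all_analysis.

Set Implicit Arguments.
Unset Strict Implicit.
Unset Printing Implicit Defensive.

Import Order.TTheory GRing.Theory Num.Theory.
Import numFieldNormedType.Exports.

Local Open Scope classical_set_scope.
Local Open Scope nat_scope.

Definition below (A : set nat) (n : nat) : set nat :=
  [set a | A a /\ a <= n].

Definition pairs_below (A B : set nat) (n : nat) : set (nat * nat) :=
  [set p | [/\ A p.1, B p.2 & p.1 + p.2 <= n]].

(* [fset_set] sends infinite sets to the empty fset; the two lemmas below rule
   that case out for the sets counted by [countf] and [sumf]. *)
Lemma finite_below (A : set nat) (n : nat) : finite_set (below A n).
Proof. by apply: (@sub_finite_set _ _ `I_n.+1) => // a [] _ /=. Qed.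

Lemma finite_pairs_below (A B : set nat) (n : nat) :
  finite_set (pairs_below A B n).
Proof.
apply: (@sub_finite_set _ _ (`I_n.+1 `*` `I_n.+1)).
  by move=> -[a b] [_ _ /= abn]; split => /=;
    rewrite ltnS (leq_trans _ abn) ?leq_addr ?leq_addl.
exact: finite_setX.
Qed.

(* A(n) *)
Definition countf (A : set nat) (n : nat) : nat := #|` fset_set (below A n)|.

(* R_{A,B}(n) *)
Definition sumf (A B : set nat) (n : nat) : nat :=
  #|` fset_set (pairs_below A B n)|.

(* [u] lists [A] in increasing order. Indices start at 0, so [u i] is the
   (i+1)-st smallest element of [A]. *)
Definition enumerates (A : set nat) (u : nat -> nat) : Prop :=
  {homo u : i j / i < j} /\ range u = A.

(* Main.v *)
Require Import Defs.
From mathcomp Require Import all_boot all_order all_algebra.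
From mathcomp Require Import cyclic separable cyclotomic finmap.
From mathcomp Require Import all_classical all_reals all_analysis.
From mathcomp Require Import complex.
From mathcomp Require Import ring lra zify.
Import Order.TTheory GRing.Theory Num.Theory.
Import numFieldNormedType.Exports.
Local Open Scope classical_set_scope.
Local Open Scope ring_scope.

Set Implicit Arguments.
Unset Strict Implicit.
Unset Printing Implicit Defensive.

(** Identify [A] and [B] with their power series, damped by [r ^ n] with
    [r = (1 - 1/x)^4], and suppose [R(n) = c (n + 1) + E(n)] with
    [E(n) = o(n^(1/4))]. Then [A B = c / (1 - r X)] up to the contribution
    of [E], and the difference [D = A - B] is small in mean square, because
    [sum_(n <= y) (A(n) - B(n))^2 = o(y)] by (1) and (2)
    ([count_diff_sq_sum_le]).

    The contradiction is a comparison of two evaluations of one mean. Let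
    [K = 1 + X + ... + X^(N-1)], let [U = A + B], and let [theta] be the Euler
    operator [X d/dX]. Consider the mean over the unit circle of
    [ |U| |theta U| |K|^2 ].
    - It is bounded below by the pairing of the coefficients of [K U] and
      [K theta U]. These are nonnegative and the coefficients of [U] are
      integers, so the diagonal terms alone give a multiple of [N x^(3/2)]
      ([window_pairing_ge], [diagonal_sum_ge]). This uses that [U]
      has mass of order [sqrt x] between [x / 16] and [x] ([psum_increment]).
    - It is bounded above through [U^2 = 4 A B + D^2], hence
      [2 U theta U = 4 theta (A B) + 2 D theta D] ([modulus_polarize]). Of the
      terms on the right, [c / (1 - r X)] contributes at most a multiple of
      [N^2 x], because [theta (1 / (1 - r X)) = r X / (1 - r X)^2] has mean
      of order [x], and [E] and [D] contribute [o(x^2)] when [N] has order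
      [sqrt x] ([spectral_inequality], [energy_pointwise],
      [energy_average]).
    With [N = sqrt x / (4 k)] the lower bound is of order [x^2 / k] and the upper
    bound of order [x^2 / k^2], which is absurd for [k] large.

    The Euler operator is what makes the argument sharp. Without it the main
    term would be the mean of [|K|^2 / |1 - r X|], of order
    [N^2 log (x / N)], and the method would only exclude errors smaller by a
    power of the logarithm. Working with [U] instead of [A] or [B] leaves no
    product of a large factor with [D].

    Means over the circle are taken over the [M]-th roots of unity, with
    polynomials of size at most [M] in place of the series; Parseval's formula
    is then exact and the truncation costs terms that vanish as the cutoff [T]
    grows ([modulus_euler_tail], [cutoff_exists]). *)

(** * Moduli of polynomials at roots of unity *)

Notation normc := ComplexField.Normc.normc.

Section Fourier.
Variable R : rcfType.
Implicit Types p q : {poly R}.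

Definition cval p (z : R[i]) : R[i] := (map_poly (real_complex R) p).[z].

Definition modulus p (z : R[i]) : R := normc (cval p z).

Lemma modulus_ge0 p z : 0 <= modulus p z.
Proof. by rewrite /modulus; case: (cval p z) => a b; exact: sqrtr_ge0. Qed.

Lemma modulusM p q z : modulus (p * q) z = modulus p z * modulus q z.
Proof.
by rewrite /modulus /cval rmorphM hornerM ComplexField.Normc.normcM.
Qed.

Lemma modulusD p q z : modulus (p + q) z <= modulus p z + modulus q z.
Proof. by rewrite /modulus /cval rmorphD hornerD le_normcD. Qed.

Lemma modulusN p z : modulus (- p) z = modulus p z.
Proof. by rewrite /modulus /cval rmorphN hornerN normcN. Qed.

Lemma modulusB p q z : modulus (p - q) z <= modulus p z + modulus q z.
Proof. by rewrite (le_trans (modulusD _ _ _))// modulusN. Qed.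

Lemma modulusC (c : R) z : modulus c%:P z = `|c|.
Proof.
by rewrite /modulus /cval map_polyC hornerC /= expr0n addr0 sqrtr_sqr.
Qed.

Lemma modulusZ (c : R) p z : modulus (c *: p) z = `|c| * modulus p z.
Proof. by rewrite -mul_polyC modulusM modulusC. Qed.

Lemma modulusX z : modulus 'X z = normc z.
Proof. by rewrite /modulus /cval map_polyX hornerX. Qed.

Lemma modulusXn p n z :
  modulus (p ^+ n) z = modulus p z ^+ n.
Proof.
elim: n => [|n IH]; first by rewrite expr0 -polyC1 modulusC normr1.
by rewrite !exprS modulusM IH.
Qed.

Lemma modulus_sum (I : Type) (r : seq I) (P : pred I) (F : I -> {poly R}) z :
  modulus (\sum_(i <- r | P i) F i) z <= \sum_(i <- r | P i) modulus (F i) z.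
Proof.
apply: (big_ind2 (fun p x => modulus p z <= x)) => [|p x q y px qy|//].
  by rewrite -polyC0 modulusC normr0.
by rewrite (le_trans (modulusD _ _ _))// lerD.
Qed.

Lemma modulus_le_coef p n z : normc z = 1 ->
  (size p <= n)%N -> modulus p z <= \sum_(i < n) `|p`_i|.
Proof.
move=> z1 sp; have -> : p = \sum_(i < n) p`_i *: 'X^i.
  by rewrite -poly_def; apply/polyP => i; rewrite coef_poly;
    case: ltnP => // ni; rewrite nth_default// (leq_trans sp).
rewrite (le_trans (modulus_sum _ _ _ _))//; apply: ler_sum => i _.
rewrite modulusZ modulusXn modulusX z1 expr1n mulr1 -poly_def coef_poly.
by rewrite ltn_ord.
Qed.

Section Roots.
Variables (M : nat) (w : R[i]).
Hypothesis (M0 : (0 < M)%N) (wM : M.-primitive_root w).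

Lemma normc_prim_root (j : nat) : normc (w ^+ j) = 1.
Proof.
have nX n : normc (w ^+ n) = normc w ^+ n.
  elim: n => [|n IH]; first by rewrite !expr0 ComplexField.Normc.normc1.
  by rewrite !exprS ComplexField.Normc.normcM IH.
have w0 : 0 <= normc w.
  by case: (w) => a b; exact: sqrtr_ge0.
rewrite nX; suff -> : normc w = 1 by rewrite expr1n.
apply/eqP; rewrite -(pexpr_eq1 M0 w0) -nX (prim_expr_order wM).
by rewrite ComplexField.Normc.normc1.
Qed.

Lemma sum_prim_root (n m : 'I_M) :
  \sum_(j < M) (w ^+ j) ^+ n * conjc ((w ^+ j) ^+ m) = (n == m)%:R * M%:R.
Proof.
have w0 : w != 0 by rewrite (prim_root_eq0 wM) -lt0n.
have cw j : conjc (w ^+ j) = (w ^+ j)^-1.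
  apply: (mulfI (expf_neq0 j w0)); rewrite -sqr_normc divff ?expf_neq0//.
  by rewrite -[X in X ^+ 2]/((normc _)%:C)%C
     normc_prim_root expr1n.
pose y := w ^+ n / w ^+ m.
rewrite (eq_bigr (fun j : 'I_M => y ^+ j)); last first.
  move=> j _; rewrite -!exprM ![(j * _)%N]mulnC cw.
  by rewrite /y exprMn exprVn -!exprM.
have [nm|nm] := eqVneq n m.
  rewrite mul1r (eq_bigr (fun=> 1)) ?sumr_const ?card_ord// => j _.
  by rewrite /y nm divff ?expf_neq0// expr1n.
rewrite mul0r.
have y1 : y - 1 != 0.
  rewrite subr_eq0; apply: contra_neq nm => yE; apply/val_inj/eqP.
  have : w ^+ n == w ^+ m.
    by rewrite -[w ^+ n](divfK (expf_neq0 m w0)) -/y yE mul1r.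
  by rewrite (eq_prim_root_expr wM) !modn_small.
apply: (mulfI y1); rewrite -subrX1 mulr0 /y exprMn exprVn -!exprM.
by rewrite ![(_ * M)%N]mulnC !exprM (prim_expr_order wM) !expr1n invr1 mulr1 subrr.
Qed.

(** Parseval's formula, polarized. *)
Lemma sum_cval_conj p q : (size p <= M)%N -> (size q <= M)%N ->
  \sum_(j < M) cval p (w ^+ j) * conjc (cval q (w ^+ j)) =
  (M%:R * \sum_(n < M) p`_n * q`_n)%:C%C.
Proof.
move=> sp sq.
have cvE (r : {poly R}) z : (size r <= M)%N -> cval r z = \sum_(n < M) (r`_n)%:C%C * z ^+ n.
  move=> sr; rewrite /cval (horner_coef_wide z (leq_trans (size_poly _ _) sr)).
  by apply: eq_bigr => n _; rewrite coef_map.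
under eq_bigr => j _ do rewrite !cvE// rmorph_sum big_distrlr /=.
rewrite exchange_big /= rmorphM rmorph_sum mulr_sumr.
apply: eq_bigr => n _; rewrite exchange_big /=.
rewrite (eq_bigr (fun m : 'I_M => (p`_n * q`_m)%:C%C * ((n == m)%:R * M%:R))).
  rewrite (bigD1 n)//= eqxx mul1r big1 ?addr0.
    by rewrite mulrC; congr (_ * _); rewrite rmorph_nat.
  by move=> m mn; rewrite eq_sym (negPf mn) mul0r mulr0.
move=> m _; rewrite -sum_prim_root mulr_sumr; apply: eq_bigr => j _.
rewrite rmorphM rmorphM /=.
by rewrite oppr0 mulrACA.
Qed.

Lemma parseval p : (size p <= M)%N ->
  \sum_(j < M) modulus p (w ^+ j) ^+ 2 = M%:R * \sum_(n < M) p`_n ^+ 2.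
Proof.
move=> sp; apply: (@complexI R); rewrite -/(_%:C)%C -sum_cval_conj// rmorph_sum.
apply: eq_bigr => j _; rewrite -sqr_normc rmorphXn; congr (_ ^+ 2).
Qed.

(** The pairing of two real coefficient sequences is the mean of a product of
    values, hence at most the mean of the product of the moduli. *)
Lemma pairing_le p q : (size p <= M)%N -> (size q <= M)%N ->
  M%:R * \sum_(n < M) p`_n * q`_n <=
  \sum_(j < M) modulus p (w ^+ j) * modulus q (w ^+ j).
Proof.
move=> sp sq; rewrite -lecR -sum_cval_conj//.
rewrite (le_trans (real_ler_norm _))//.
  by rewrite sum_cval_conj// complex_real.
rewrite (le_trans (ler_norm_sum _ _ _))// rmorph_sum ler_sum// => j _.
by rewrite normrM normcJ rmorphM.
Qed.
End Roots.

(** [X^M - 1] splits over the algebraically closed field [R[i]] and is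
    separable in characteristic zero. *)
Lemma prim_root_exists (M : nat) : (0 < M)%N ->
  exists w : R[i], M.-primitive_root w.
Proof.
move=> M0; have [s Ds] := closed_field_poly_normal ('X^M - 1 : {poly R[i]}).
rewrite (monicP (monicXnsubC 1 M0)) scale1r in Ds.
have sM : size s = M.
  by apply: succn_inj; rewrite -(size_prod_XsubC s id) -Ds size_XnsubC.
have us : uniq s.
  by rewrite -separable_prod_XsubC -Ds separable_Xn_sub_1// pnatr_eq0 -lt0n.
have rs : all M.-unity_root s.
  by apply/allP => z; rewrite -root_prod_XsubC -Ds.
have Ms : (M <= size s)%N by rewrite sM.
by have /hasP[w _ wM] := has_prim_root M0 rs us Ms; exists w.
Qed.
End Fourier.

(** * The Euler operator on truncated generating polynomials *)

Definition euler (R : nzRingType) (p : {poly R}) : {poly R} := 'X * p^`().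

Lemma coef_euler (R : rcfType) (p : {poly R}) n : (euler p)`_n = n%:R * p`_n.
Proof.
rewrite /euler coefXM; case: n => [|n] /=; first by rewrite mul0r.
by rewrite coef_deriv mulr_natl.
Qed.

Lemma size_euler (R : rcfType) (p : {poly R}) n : (size p <= n)%N -> (size (euler p) <= n)%N.
Proof.
move=> /leq_sizeP sp; apply/leq_sizeP => i /sp; rewrite coef_euler => ->.
by rewrite mulr0.
Qed.

Lemma eulerD (R : rcfType) (p q : {poly R}) : euler (p + q) = euler p + euler q.
Proof. by rewrite /euler derivD mulrDr. Qed.

Lemma eulerB (R : rcfType) (p q : {poly R}) : euler (p - q) = euler p - euler q.
Proof. by rewrite /euler derivB mulrBr. Qed.

Lemma eulerZ (R : rcfType) (c : R) (p : {poly R}) : euler (c *: p) = c *: euler p.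
Proof. by rewrite /euler derivZ scalerAr. Qed.

Lemma eulerM (R : rcfType) (p q : {poly R}) : euler (p * q) = euler p * q + p * euler q.
Proof. by rewrite /euler derivM; ring. Qed.

Lemma eulerXn (R : rcfType) n : euler ('X^n : {poly R}) = n%:R *: 'X^n.
Proof.
by apply/polyP => i; rewrite coef_euler coefZ coefXn; case: eqVneq => [->|];
  rewrite ?mulr0.
Qed.

Lemma euler_sub1X (R : rcfType) (r : R) : euler (1 - r *: 'X) = - (r *: 'X).
Proof.
by rewrite /euler derivB derivZ derivX derivC sub0r mulrN -scalerAr mulr1.
Qed.

Definition genpoly (R : rcfType) (T : nat) (r : R) (e : nat -> R) : {poly R} :=
  \poly_(n < T) (e n * r ^+ n).

Lemma coef_genpoly (R : rcfType) T (r : R) e n :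
  (genpoly T r e)`_n = if (n < T)%N then e n * r ^+ n else 0.
Proof. by rewrite coef_poly. Qed.

Lemma size_genpoly (R : rcfType) T (r : R) e : (size (genpoly T r e) <= T)%N.
Proof. exact: size_poly. Qed.

Lemma genpolyD (R : rcfType) T (r : R) (e f : nat -> R) :
  genpoly T r (fun n => e n + f n) = genpoly T r e + genpoly T r f.
Proof.
by apply/polyP => n; rewrite coefD !coef_genpoly; case: ltnP; rewrite ?addr0// mulrDl.
Qed.

Lemma genpolyB (R : rcfType) T (r : R) (e f : nat -> R) :
  genpoly T r (fun n => e n - f n) = genpoly T r e - genpoly T r f.
Proof.
by apply/polyP => n; rewrite coefB !coef_genpoly; case: ltnP; rewrite ?subr0// mulrBl.
Qed.

(** The value before index 0 is read as 0, which makes [nabla] the inverse of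
    partial summation. *)
Definition nabla (R : rcfType) (e : nat -> R) n : R := e n - (if n is m.+1 then e m else 0).

(** Summation by parts; the last term is the price of cutting at [T]. *)
Lemma genpoly_nabla (R : rcfType) T (r : R) e :
  genpoly T.+1 r (nabla e) =
  (1 - r *: 'X) * genpoly T.+1 r e + (e T * r ^+ T.+1) *: 'X^(T.+1).
Proof.
apply/polyP => n; rewrite mulrBl mul1r -scalerAl coefD coefB !coefZ coefXM coefXn.
rewrite !coef_genpoly /nabla; case: n => [|n] /=; first by rewrite mulr0 mulr0 !subr0 addr0.
rewrite !ltnS eqSS; case: (ltngtP n T) => [nT|nT|->].
- by rewrite mulr0 addr0 exprS mulrBl [r * (e n * _)]mulrCA.
- by rewrite mulr0 mulr0 subr0 addr0.
- by rewrite mulr1 exprS mulrCA sub0r addNr.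
Qed.

Lemma euler_genpoly_nabla (R : rcfType) T (r : R) e :
  euler (genpoly T.+1 r (nabla e)) =
  (1 - r *: 'X) * euler (genpoly T.+1 r e) - (r *: 'X) * genpoly T.+1 r e
  + (T.+1%:R * (e T * r ^+ T.+1)) *: 'X^(T.+1).
Proof.
rewrite genpoly_nabla eulerD eulerM euler_sub1X eulerZ eulerXn scalerA.
by rewrite [_ * T.+1%:R]mulrC; ring.
Qed.

Definition window (R : rcfType) (N : nat) : {poly R} := \sum_(i < N) 'X^i.

Lemma coef_window (R : rcfType) N n : (window R N)`_n = (n < N)%:R.
Proof.
rewrite /window (_ : \sum_(i < N) _ = \poly_(i < N) 1).
  by rewrite coef_poly; case: ltnP.
by rewrite poly_def; apply: eq_bigr => i _; rewrite scale1r.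
Qed.

Lemma size_window (R : rcfType) N : (size (window R N) <= N)%N.
Proof. by apply/leq_sizeP => i; rewrite coef_window ltnNge => ->. Qed.

Lemma modulusXn1 (R : rcfType) (z : R[i]) n : normc z = 1 -> modulus 'X^n z = 1.
Proof. by move=> z1; rewrite modulusXn modulusX z1 expr1n. Qed.

Lemma modulus1 (R : rcfType) (z : R[i]) : modulus 1 z = 1.
Proof. by rewrite -polyC1 modulusC normr1. Qed.

Lemma modulusX1 (R : rcfType) (z : R[i]) : normc z = 1 -> modulus 'X z = 1.
Proof. by move=> z1; rewrite modulusX. Qed.

Lemma modulus_window (R : rcfType) (z : R[i]) N : normc z = 1 ->
  modulus (window R N) z <= N%:R.
Proof.
move=> z1; rewrite (le_trans (modulus_sum _ _ _ _))//.
rewrite (eq_bigr (fun=> 1)) ?sumr_const ?card_ord// => i _.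
by rewrite modulusXn1.
Qed.

(** The product [(1 - X) (1 + ... + X^(N-1)) = 1 - X^N] telescopes, and
    [1 - r X] differs from [1 - X] by [(1 - r) X], whose product with the
    window is at most [(1 - r) N <= 1]. *)
Lemma modulus_window_sub1X (R : rcfType) (z : R[i]) N (r : R) :
  normc z = 1 -> r <= 1 -> (1 - r) * N%:R <= 1 ->
  modulus (window R N * (1 - r *: 'X)) z <= 3.
Proof.
move=> z1 r1 rN.
have -> : window R N * (1 - r *: 'X) =
    (1 - 'X^N) + ((1 - r) *: 'X) * window R N.
  have := subrX1 'X N; rewrite -/(window R N) => E.
  have -> : 1 - 'X^N = - (('X - 1) * window R N) by rewrite -E opprB.
  by rewrite scalerBl scale1r; ring.
rewrite (le_trans (modulusD _ _ _))// (le_trans (lerD (modulusB _ _ _) (lexx _)))//.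
rewrite modulus1 modulusXn1// modulusM modulusZ modulusX1// mulr1.
rewrite ger0_norm; last lra.
have : (1 - r) * modulus (window R N) z <= (1 - r) * N%:R.
  by rewrite ler_wpM2l ?modulus_window//; lra.
lra.
Qed.

Lemma modulus_window_genpoly_nabla (R : rcfType) (z : R[i]) N (r : R) T e :
  normc z = 1 -> 0 <= r -> r <= 1 -> (1 - r) * N%:R <= 1 ->
  modulus (window R N * genpoly T.+1 r (nabla e)) z <=
  3 * modulus (genpoly T.+1 r e) z + N%:R * (`|e T| * r ^+ T.+1).
Proof.
move=> z1 r0 r1 rN; rewrite genpoly_nabla mulrDr [window R N * (_ * _)]mulrA.
rewrite (le_trans (modulusD _ _ _))// lerD//.
  by rewrite modulusM ler_wpM2r ?modulus_ge0 ?modulus_window_sub1X.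
rewrite modulusM modulusZ modulusXn1// mulr1 normrM [ `|_ ^+ _| ]ger0_norm ?exprn_ge0//.
by rewrite ler_wpM2r ?modulus_window// mulr_ge0 ?exprn_ge0//; lra.
Qed.

Lemma modulus_window_euler_genpoly_nabla (R : rcfType) (z : R[i]) N (r : R) T e :
  normc z = 1 -> 0 <= r -> r <= 1 -> (1 - r) * N%:R <= 1 ->
  modulus (window R N * euler (genpoly T.+1 r (nabla e))) z <=
  3 * modulus (euler (genpoly T.+1 r e)) z + N%:R * modulus (genpoly T.+1 r e) z
  + N%:R * (T.+1%:R * (`|e T| * r ^+ T.+1)).
Proof.
move=> z1 r0 r1 rN; rewrite euler_genpoly_nabla mulrDr mulrBr.
rewrite [window R N * (_ * _)]mulrA (le_trans (modulusD _ _ _))// lerD//.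
  rewrite (le_trans (modulusB _ _ _))// lerD//.
    by rewrite modulusM ler_wpM2r ?modulus_ge0 ?modulus_window_sub1X.
  rewrite !modulusM modulusZ modulusX1// mulr1 ger0_norm; last lra.
  rewrite ler_pM ?modulus_ge0 ?modulus_window// ?mulr_ge0 ?modulus_ge0//.
  by rewrite ler_piMl ?modulus_ge0//; lra.
rewrite modulusM modulusZ modulusXn1// mulr1 !normrM normr_nat.
rewrite [ `|_ ^+ _| ]ger0_norm ?exprn_ge0//.
by rewrite ler_wpM2r ?modulus_window// !mulr_ge0 ?exprn_ge0//; lra.
Qed.

(** The full geometric series satisfies [euler Q = r X Q^2]; the truncated one
    satisfies it up to boundary terms carrying the factor [r ^ T]. Thus the
    main term has the mean of [|Q|^2], which Parseval evaluates. *)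
Lemma modulus_euler_geom (R : rcfType) (z : R[i]) (r : R) T :
  normc z = 1 -> 0 <= r -> r <= 1 -> r ^+ T <= 1 / 2 -> T%:R * r ^+ T <= 1 ->
  modulus (euler (genpoly T r (fun=> 1))) z <=
  3 * modulus (genpoly T r (fun=> 1)) z ^+ 2 + 1.
Proof.
move=> z1 r0 r1 rT TrT; set Q := genpoly T r _.
have QE : (1 - r *: 'X) * Q = 1 - r ^+ T *: 'X^T.
  case: T @Q {rT TrT} => [|T] Q.
    by rewrite !expr0 scale1r subrr /Q /genpoly poly_def big_ord0 mulr0.
  have := genpoly_nabla T r (fun=> 1); rewrite -/Q mul1r => /eqP; rewrite -subr_eq => /eqP <-.
  congr (_ - _); apply/polyP => -[|n]; rewrite coef_genpoly coefC /nabla /=.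
    by rewrite subr0 expr0 mul1r.
  by rewrite subrr mul0r if_same.
have EQ : (1 - r ^+ T *: 'X^T) * euler Q =
  (r *: 'X) * Q * Q - (T%:R * r ^+ T) *: 'X^T * Q.
  have : euler ((1 - r *: 'X) * Q) = - ((T%:R * r ^+ T) *: 'X^T).
    rewrite QE -scaleN1r eulerD !eulerZ eulerXn -polyC1 /euler derivC mulr0 add0r.
    by rewrite scaleN1r scalerA mulrC.
  rewrite eulerM euler_sub1X -QE => H.
  have -> : (T%:R * r ^+ T) *: 'X^T = (r *: 'X) * Q - (1 - r *: 'X) * euler Q.
    by rewrite -[LHS]opprK -H opprD mulNr opprK.
  ring.
have EE : euler Q = (r *: 'X) * Q * Q - (T%:R * r ^+ T) *: 'X^T * Q +
    (r ^+ T *: 'X^T) * euler Q.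
  by rewrite -EQ; ring.
have rT0 : 0 <= r ^+ T by rewrite exprn_ge0.
have le1 : modulus ((r *: 'X) * Q * Q) z <= modulus Q z ^+ 2.
  rewrite !modulusM modulusZ modulusX1// mulr1 ger0_norm// -mulrA -expr2.
  by rewrite ler_piMl// sqr_ge0.
have le2 : modulus ((T%:R * r ^+ T) *: 'X^T * Q) z <= modulus Q z.
  rewrite modulusM modulusZ modulusXn1// mulr1 ger0_norm ?mulr_ge0//.
  by rewrite ler_piMl// modulus_ge0.
have le3 : modulus ((r ^+ T *: 'X^T) * euler Q) z <= 1 / 2 * modulus (euler Q) z.
  rewrite modulusM modulusZ modulusXn1// mulr1 ger0_norm//.
  by rewrite ler_wpM2r// modulus_ge0.
have : modulus (euler Q) z <= modulus Q z ^+ 2 + modulus Q z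
    + 1 / 2 * modulus (euler Q) z.
  rewrite {1}EE (le_trans (modulusD _ _ _))// lerD//.
  by rewrite (le_trans (modulusB _ _ _))// lerD.
have := sqr_ge0 (modulus Q z - 1).
move: (modulus Q z) (modulus (euler Q) z) => u v.
nra.
Qed.

(** * The diagonal lower bound and the tail of a product *)

Lemma euler_genpoly (R : rcfType) T (r : R) e :
  euler (genpoly T r e) = genpoly T r (fun n => n%:R * e n).
Proof.
by apply/polyP => n; rewrite coef_euler !coef_genpoly; case: ltnP; rewrite ?mulr0// mulrA.
Qed.

Lemma parseval_genpoly (R : rcfType) (M : nat) (w : R[i]) T (r : R) e :
  (0 < M)%N -> M.-primitive_root w -> (T <= M)%N ->
  \sum_(j < M) modulus (genpoly T r e) (w ^+ j) ^+ 2 =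
  M%:R * \sum_(n < T) (e n * r ^+ n) ^+ 2.
Proof.
move=> M0 wM TM; rewrite (parseval M0 wM) ?(leq_trans (size_genpoly _ _ _))//.
congr (_ * _); rewrite (big_ord_widen _ (fun n => (e n * r ^+ n) ^+ 2) TM) [RHS]big_mkcond /=.
by apply: eq_bigr => n _; rewrite coef_genpoly; case: ltnP => // _; rewrite expr0n.
Qed.

Lemma parseval_window (R : rcfType) (M : nat) (w : R[i]) N :
  (0 < M)%N -> M.-primitive_root w -> (N <= M)%N ->
  \sum_(j < M) modulus (window R N) (w ^+ j) ^+ 2 = M%:R * N%:R.
Proof.
move=> M0 wM NM; have -> : window R N = genpoly N 1 (fun=> 1).
  by apply/polyP => n; rewrite coef_window coef_genpoly expr1n mulr1; case: ltnP.
rewrite (parseval_genpoly _ _ M0 wM NM); congr (_ * _).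
by rewrite (eq_bigr (fun=> 1)) ?sumr_const ?card_ord// => n _; rewrite expr1n mulr1 expr1n.
Qed.

Lemma sum_mul_ge_diag (R : realDomainType) n (f g : 'I_n -> R) :
  (forall i, 0 <= f i) -> (forall i, 0 <= g i) ->
  \sum_i f i * g i <= (\sum_i f i) * (\sum_i g i).
Proof.
move=> f0 g0; rewrite mulr_suml ler_sum// => i _; rewrite ler_wpM2l//.
by rewrite (bigD1 i)//= lerDl sumr_ge0.
Qed.

Lemma sum_coef_horner1 (R : comNzRingType) (p : {poly R}) M : (size p <= M)%N ->
  \sum_(n < M) p`_n = p.[1].
Proof.
move=> sp; rewrite (horner_coef_wide _ sp); apply: eq_bigr => i _.
by rewrite expr1n mulr1.
Qed.

(** Every product of two window sums is at least its diagonal part, and each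
    index [m] lies in [N] windows. *)
Lemma window_pairing_ge (R : rcfType) (M : nat) (w : R[i]) N T (r : R) (u v : nat -> R) :
  (0 < M)%N -> M.-primitive_root w -> (N + T <= M)%N ->
  0 <= r -> (forall n, 0 <= u n) -> (forall n, 0 <= v n) ->
  M%:R * (N%:R * \sum_(m < T) u m * v m * r ^+ (2 * m)) <=
  \sum_(j < M) modulus (window R N * genpoly T r u) (w ^+ j) *
               modulus (window R N * genpoly T r v) (w ^+ j).
Proof.
move=> M0 wM NTM r0 u0 v0.
have sz e : (size (window R N * genpoly T r e)%R <= M)%N.
  rewrite (leq_trans (size_polyMleq _ _))// (leq_trans (leq_pred _))//.
  by rewrite (leq_trans _ NTM)// leq_add ?size_window ?size_genpoly.
apply: le_trans (pairing_le M0 wM (sz u) (sz v)).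
rewrite ler_wpM2l//.
(* Evaluating at 1 the window times the pointwise product counts each diagonal
   term once for every window. *)
have -> : N%:R * \sum_(m < T) u m * v m * r ^+ (2 * m) =
    (window R N * genpoly T (r ^+ 2) (fun m => u m * v m)).[1].
  rewrite hornerM -!(sum_coef_horner1 (size_window _ _)) -(sum_coef_horner1 (size_genpoly _ _ _)).
  congr (_ * _).
    under eq_bigr => i _ do rewrite coef_window ltn_ord.
    by rewrite sumr_const card_ord.
  by apply: eq_bigr => i _; rewrite coef_genpoly ltn_ord exprM.
rewrite -(sum_coef_horner1 (M := M)); last first.
  rewrite (leq_trans (size_polyMleq _ _))// (leq_trans (leq_pred _))//.
  by rewrite (leq_trans _ NTM)// leq_add ?size_window ?size_genpoly.
apply: ler_sum => n _; rewrite !coefM.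
have genpoly_ge0 e m : (forall n, 0 <= e n) -> 0 <= (genpoly T r e)`_m.
  by move=> e0; rewrite coef_genpoly; case: ltnP => // _; rewrite mulr_ge0 ?exprn_ge0.
apply: le_trans (sum_mul_ge_diag _ _); last first.
- by move=> i; rewrite mulr_ge0 ?genpoly_ge0// coef_window.
- by move=> i; rewrite mulr_ge0 ?genpoly_ge0// coef_window.
apply: ler_sum => i _; rewrite coef_window !coef_genpoly.
case: (i < N)%N; last by rewrite !mul0r.
rewrite !mul1r; case: ltnP => _; rewrite ?mul0r//.
by rewrite mulrACA -expr2 -!exprM mulnC.
Qed.

Definition convolution (R : rcfType) (a b : nat -> R) n : R :=
  \sum_(i < n.+1) a i * b (n - i)%N.

(** Below the cutoff the coefficients of the truncated product are those of the
    full product; beyond it each is a sum of at most [n + 1] terms bounded by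
    [r ^ n]. *)
Lemma modulus_euler_tail (R : rcfType) (z : R[i]) T (r : R) (a b : nat -> R) :
  normc z = 1 -> 0 <= r ->
  (forall n, 0 <= a n <= 1) -> (forall n, 0 <= b n <= 1) ->
  modulus (euler (genpoly T r a * genpoly T r b - genpoly T r (convolution a b))) z <=
  \sum_(n < T.*2 | (T <= n)%N) n%:R * (n.+1%:R * r ^+ n).
Proof.
move=> z1 r0 a01 b01; set p := _ - _.
have sp : (size p <= T.*2)%N.
  rewrite (leq_trans (size_polyD _ _))// geq_max size_polyN.
  rewrite (leq_trans (size_polyMleq _ _))//=.
    by rewrite (leq_trans (size_genpoly _ _ _))// -addnn leq_addr.
  by rewrite (leq_trans (leq_pred _))// -addnn leq_add ?size_genpoly.
rewrite (le_trans (modulus_le_coef z1 (size_euler sp)))// [leRHS]big_mkcond /=.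
apply: ler_sum => n _; rewrite coef_euler normrM normr_nat.
rewrite coefB coefM coef_genpoly; case: ltnP => nT; last first.
  rewrite subr0 ler_wpM2l// (le_trans (ler_norm_sum _ _ _))//.
  rewrite (_ : n.+1%:R * r ^+ n = \sum_(i < n.+1) r ^+ n);
    last by rewrite sumr_const card_ord mulr_natl.
  rewrite ler_sum// => i _.
  rewrite !coef_genpoly; do 2 (case: ltnP => _; rewrite ?mul0r ?mulr0 ?normr0 ?exprn_ge0//).
  have /andP[a0 a1] := a01 i; have /andP[b0 b1] := b01 (n - i)%N.
  have ni : (i <= n)%N by rewrite -ltnS.
  rewrite mulrACA -exprD subnKC// ger0_norm ?mulr_ge0 ?exprn_ge0//.
  by rewrite ler_piMl ?exprn_ge0// mulr_ile1.
rewrite /convolution mulr_suml -sumrB big1 ?normr0 ?mulr0// => i _.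
have ni : (i <= n)%N by rewrite -ltnS.
rewrite !coef_genpoly (leq_ltn_trans ni nT) (leq_ltn_trans (leq_subr _ _) nT).
by rewrite mulrACA -exprD subnKC// subrr.
Qed.

(** * The two sides compared *)

Definition count_diff (R : rcfType) (a b : nat -> R) n : R := \sum_(m < n.+1) (a m - b m).

(** The comparison is with [c (n + 1)], not [c n], so that
    [nabla (sum_err a b c) = convolution a b - c] holds at 0 as well. *)
Definition sum_err (R : rcfType) (a b : nat -> R) (c : R) n : R :=
  \sum_(m < n.+1) convolution a b m - c * n.+1%:R.

Definition sqnorm (R : rcfType) (T : nat) (r : R) (e : nat -> R) : R :=
  \sum_(n < T) (e n * r ^+ n) ^+ 2.

Lemma nabla_count_diff (R : rcfType) (a b : nat -> R) n : nabla (count_diff a b) n = a n - b n.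
Proof.
rewrite /nabla /count_diff big_ord_recr /=; case: n => [|n] /=.
  by rewrite big_ord0 add0r subr0.
by rewrite [X in X - _]addrC addrK.
Qed.

Lemma nabla_sum_err (R : rcfType) (a b : nat -> R) c n :
  nabla (sum_err a b c) n = convolution a b n - c.
Proof.
rewrite /nabla /sum_err big_ord_recr /=; case: n => [|n] /=.
  by rewrite big_ord0 add0r subr0 mulr1.
rewrite -[n.+2%:R]natr1 mulrDr mulr1; move: (\sum_(i < n.+1) _) => s.
move: (convolution a b n.+1) (c * n.+1%:R) => u v; lra.
Qed.

Lemma eq_genpoly (R : rcfType) T (r : R) e f : e =1 f -> genpoly T r e = genpoly T r f.
Proof. by move=> ef; apply/polyP => n; rewrite !coef_genpoly ef. Qed.

(** Apply the Euler operator to [(A + B)^2 = 4 A B + (A - B)^2]. *)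
Lemma modulus_polarize (R : rcfType) (z : R[i]) (A B : {poly R}) :
  2 * (modulus (A + B) z * modulus (euler (A + B)) z) <=
  4 * modulus (euler (A * B)) z + 2 * (modulus (A - B) z * modulus (euler (A - B)) z).
Proof.
have E : 2%:R *: ((A + B) * euler (A + B)) =
    4%:R *: euler (A * B) + 2%:R *: ((A - B) * euler (A - B)).
  rewrite -!mul_polyC !polyC_natr eulerB eulerD eulerM; ring.
have := modulusD (4%:R *: euler (A * B)) (2%:R *: ((A - B) * euler (A - B))) z.
by rewrite -E !modulusZ !modulusM !normr_nat.
Qed.

Lemma two_mul_le (R : rcfType) (l s t : R) : 0 < l ->
  2 * (s * t) <= l * s ^+ 2 + t ^+ 2 / l.
Proof.
move=> l0; rewrite -subr_ge0.
have -> : l * s ^+ 2 + t ^+ 2 / l - 2 * (s * t) = (l * s - t) ^+ 2 / l.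
  by field; rewrite gt_eqF.
by rewrite divr_ge0 ?sqr_ge0 ?ltW.
Qed.

Lemma sqr_sum3_le (R : rcfType) (u v w : R) :
  (u + v + w) ^+ 2 <= 3 * (u ^+ 2 + v ^+ 2 + w ^+ 2).
Proof.
have := sqr_ge0 (u - v); have := sqr_ge0 (u - w); have := sqr_ge0 (v - w); nra.
Qed.

(** The right-hand side collects, in this order, the main term
    [c / (1 - r X)], the error [E], the tail of [A B], and the last two lines
    come from [D]. The weights [lambda] and [x] turn products of moduli into
    sums of squares, the only quantities that Parseval's formula evaluates. *)
Lemma spectral_pointwise (R : rcfType) (N T : nat) (r c x lambda : R)
    (a b : nat -> R) (z : R[i]) :
  let d := count_diff a b in let E := sum_err a b c in let G := genpoly T.+1 r in
  normc z = 1 ->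
  0 <= r -> r <= 1 -> (1 - r) * N%:R <= 1 ->
  0 < c -> 0 < x -> 0 < lambda ->
  (forall n, 0 <= a n <= 1) -> (forall n, 0 <= b n <= 1) ->
  r ^+ T.+1 <= 1 / 2 -> T.+1%:R * r ^+ T.+1 <= 1 ->
  N%:R * (T.+1%:R * (`|E T| * r ^+ T.+1)) <= 1 ->
  N%:R * (T.+1%:R * (`|d T| * r ^+ T.+1)) <= 1 ->
  \sum_(n < T.+1.*2 | (T.+1 <= n)%N) n%:R * (n.+1%:R * r ^+ n) <= 1 ->
  2 * (modulus (window R N * G (fun n => a n + b n)) z *
       modulus (window R N * G (fun n => n%:R * (a n + b n))) z) <=
    4 * c * N%:R ^+ 2 * (3 * modulus (G (fun=> 1)) z ^+ 2 + 1)
    + 2 * (lambda * modulus (window R N) z ^+ 2 +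
           3 * (9 * modulus (G (fun n => n%:R * E n)) z ^+ 2
                + N%:R ^+ 2 * modulus (G E) z ^+ 2 + 1) / lambda)
    + 4 * N%:R ^+ 2
    + x * (18 * modulus (G d) z ^+ 2 + 2)
    + 3 * (9 * modulus (G (fun n => n%:R * d n)) z ^+ 2
           + N%:R ^+ 2 * modulus (G d) z ^+ 2 + 1) / x.
Proof.
move=> d E G z1 r0 r1 rN c0 x0 l0 a01 b01 rT TrT bE bd tail.
have EG e : G (fun n => n%:R * e n) = euler (G e) by rewrite /G euler_genpoly.
rewrite (EG (fun n => a n + b n)) (EG E) (EG d).
set k := modulus (window R N) z; have k0 : 0 <= k by exact: modulus_ge0.
have kN : k <= N%:R by exact: modulus_window.
set U := G (fun n => a n + b n).
have UE : U = G a + G b by exact: genpolyD.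
(* The partial sums of [a - b] and of [convolution a b - c] are [d] and [E], so
   [D] and [A B] are images of small sequences under [nabla]. *)
set D := G (nabla d).
have DE : D = G a - G b by rewrite -genpolyB; apply: eq_genpoly => n; exact: nabla_count_diff.
have ABE : G a * G b = c *: G (fun=> 1) + G (nabla E) + (G a * G b - G (convolution a b)).
  have -> : G (convolution a b) = c *: G (fun=> 1) + G (nabla E).
    have -> : c *: G (fun=> 1) = G (fun=> c).
      by apply/polyP => n; rewrite coefZ !coef_genpoly; case: ltnP; rewrite ?mulr0// mul1r.
    by rewrite -genpolyD; apply: eq_genpoly => n; rewrite nabla_sum_err addrC subrK.
  by rewrite addrC subrK.
have t1 := le_trans (modulus_euler_tail T.+1 z1 r0 a01 b01) tail.
rewrite -/G in t1.
have q1 := modulus_euler_geom z1 r0 r1 rT TrT; rewrite -/G in q1.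
have e1 := modulus_window_euler_genpoly_nabla T E z1 r0 r1 rN; rewrite -/G in e1.
have d0 := modulus_window_genpoly_nabla T d z1 r0 r1 rN; rewrite -/G in d0.
have d1 := modulus_window_euler_genpoly_nabla T d z1 r0 r1 rN; rewrite -/G in d1.
have d0' : N%:R * (`|d T| * r ^+ T.+1) <= 1.
  apply: le_trans bd; rewrite ler_wpM2l// ler_peMl ?mulr_ge0 ?exprn_ge0//.
  by rewrite ler1n.
have pol := modulus_polarize z (G a) (G b).
rewrite -UE -DE in pol.
set tl := G a * G b - G (convolution a b) in ABE t1; clearbody tl.
have ab : modulus (euler (G a * G b)) z <= c * modulus (euler (G (fun=> 1))) z
    + modulus (euler (G (nabla E))) z + 1.
  rewrite {1}ABE !eulerD (le_trans (modulusD _ _ _))// lerD//.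
  by rewrite (le_trans (modulusD _ _ _))// eulerZ modulusZ gtr0_norm.
move: e1 d0 d1; rewrite -/D !(modulusM (window R N)) -/k.
have := modulus_ge0 (euler (G (nabla E))) z.
have := modulus_ge0 (euler D) z.
have := modulus_ge0 D z.
have := modulus_ge0 (G E) z; have := modulus_ge0 (euler (G E)) z.
have := modulus_ge0 (G d) z; have := modulus_ge0 (euler (G d)) z.
move: pol ab q1.
move: (modulus U z) (modulus (euler U) z) (modulus (euler (G a * G b)) z).
move: (modulus D z) (modulus (euler D) z) (modulus (euler (G (nabla E))) z).
move: (modulus (G (fun=> 1)) z) (modulus (euler (G (fun=> 1))) z).
move: (modulus (G E) z) (modulus (euler (G E)) z).
move: (modulus (G d) z) (modulus (euler (G d)) z).
move=> ad bd' aE bE' Q qe v v' s u u' p pol ab q1 ad0 bd0 aE0 bE0 v0 v'0 s0 e1 d0 d1.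
have [l0' x0'] := (ltW l0, ltW x0).
have n0 : 0 <= N%:R :> R by exact: ler0n.
set n := N%:R in kN n0 e1 d0 d1 bE bd d0' *.
have e2 : k * s <= 3 * bE' + n * aE + 1 by lra.
have d2 : k * v <= 3 * ad + 1 by lra.
have d3 : k * v' <= 3 * bd' + n * ad + 1 by lra.
have k2 : k ^+ 2 <= n ^+ 2 by rewrite lerXn2r.
have step1 : 2 * (k * u * (k * u')) <= 4 * (k ^+ 2 * p) + 2 * ((k * v) * (k * v')).
  have -> : 2 * (k * u * (k * u')) = k ^+ 2 * (2 * (u * u')) by ring.
  have -> : 4 * (k ^+ 2 * p) + 2 * ((k * v) * (k * v')) =
    k ^+ 2 * (4 * p + 2 * (v * v')) by ring.
  by rewrite ler_wpM2l// sqr_ge0.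
have step2 : k ^+ 2 * p <= c * (n ^+ 2 * (3 * Q ^+ 2 + 1)) + k * (3 * bE' + n * aE + 1) + n ^+ 2.
  have h1 : k ^+ 2 * p <= k ^+ 2 * (c * (3 * Q ^+ 2 + 1) + s + 1).
    rewrite ler_wpM2l ?sqr_ge0// (le_trans ab)// lerD2r lerD2r.
    by rewrite ler_wpM2l// ltW.
  have h2 : k ^+ 2 * (c * (3 * Q ^+ 2 + 1)) <= n ^+ 2 * (c * (3 * Q ^+ 2 + 1)).
    apply: ler_wpM2r => //; apply: mulr_ge0; first exact: ltW.
    by have := sqr_ge0 Q; lra.
  have h3 : k * (k * s) <= k * (3 * bE' + n * aE + 1) by rewrite ler_wpM2l.
  nra.
have step3 : 2 * (k * (3 * bE' + n * aE + 1)) <= lambda * k ^+ 2 +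
    3 * (9 * bE' ^+ 2 + n ^+ 2 * aE ^+ 2 + 1) / lambda.
  apply: (le_trans (two_mul_le _ _ l0)); rewrite lerD2l ler_wpM2r ?invr_ge0//.
  by rewrite (le_trans (sqr_sum3_le _ _ _))// !exprMn expr1n; lra.
have step4 : 2 * ((k * v) * (k * v')) <= x * (18 * ad ^+ 2 + 2) +
    3 * (9 * bd' ^+ 2 + n ^+ 2 * ad ^+ 2 + 1) / x.
  apply: (@le_trans _ _ (2 * ((3 * ad + 1) * (3 * bd' + n * ad + 1)))).
    by rewrite ler_wpM2l// ler_pM ?mulr_ge0.
  apply: (le_trans (two_mul_le _ _ x0)); rewrite lerD//.
    rewrite ler_wpM2l//; have := sqr_ge0 (3 * ad - 1); nra.
  rewrite ler_wpM2r ?invr_ge0//.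
  by rewrite (le_trans (sqr_sum3_le _ _ _))// !exprMn expr1n; lra.
have -> : 4 * c * n ^+ 2 * (3 * Q ^+ 2 + 1) = 4 * (c * (n ^+ 2 * (3 * Q ^+ 2 + 1))) by ring.
lra.
Qed.

(** The mean of [spectral_pointwise] over the roots of unity. *)
Lemma spectral_inequality (R : rcfType) (N T : nat) (r c x lambda : R)
    (a b : nat -> R) :
  let d := count_diff a b in let E := sum_err a b c in let W := sqnorm T.+1 r in
  0 <= r -> r <= 1 -> (1 - r) * N%:R <= 1 ->
  0 < c -> 0 < x -> 0 < lambda ->
  (forall n, 0 <= a n <= 1) -> (forall n, 0 <= b n <= 1) ->
  r ^+ T.+1 <= 1 / 2 -> T.+1%:R * r ^+ T.+1 <= 1 ->
  N%:R * (T.+1%:R * (`|E T| * r ^+ T.+1)) <= 1 ->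
  N%:R * (T.+1%:R * (`|d T| * r ^+ T.+1)) <= 1 ->
  \sum_(n < T.+1.*2 | (T.+1 <= n)%N) n%:R * (n.+1%:R * r ^+ n) <= 1 ->
  2 * (N%:R * \sum_(m < T.+1) (a m + b m) * (m%:R * (a m + b m)) * r ^+ (2 * m)) <=
    4 * c * N%:R ^+ 2 * (3 * W (fun=> 1) + 1)
    + 2 * (lambda * N%:R +
           3 * (9 * W (fun n => n%:R * E n) + N%:R ^+ 2 * W E + 1) / lambda)
    + 4 * N%:R ^+ 2
    + x * (18 * W d + 2)
    + 3 * (9 * W (fun n => n%:R * d n) + N%:R ^+ 2 * W d + 1) / x.
Proof.
move=> d E W r0 r1 rN c0 x0 l0 a01 b01 rT TrT bE bd tail.
(* With this many roots all products of the window with a generating polynomial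
   have size at most [M]. *)
pose M := (N + T.+1)%N.
have M0 : (0 < M)%N by rewrite /M addnS.
have [w wM] := prim_root_exists R M0.
have M0R : 0 < M%:R :> R by rewrite ltr0n.
have u0 n : 0 <= a n + b n.
  by have /andP[a0 _] := a01 n; have /andP[b0 _] := b01 n; rewrite addr_ge0.
have nu0 n : 0 <= n%:R * (a n + b n) by rewrite mulr_ge0.
rewrite -(ler_pM2l M0R) [leLHS]mulrCA.
apply: (le_trans (ler_wpM2l (ler0n R 2) (window_pairing_ge M0 wM (leqnn _) r0 u0 nu0))).
rewrite mulr_sumr.
have NM : (N <= M)%N by exact: leq_addr.
have TM : (T.+1 <= M)%N by exact: leq_addl.
have WE e : M%:R * W e = \sum_(j < M) modulus (genpoly T.+1 r e) (w ^+ j) ^+ 2.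
  by rewrite (parseval_genpoly _ _ M0 wM TM).
have NE : M%:R * N%:R = \sum_(j < M) modulus (window R N) (w ^+ j) ^+ 2.
  by rewrite (parseval_window M0 wM NM).
have ME : M%:R = \sum_(j < M) 1 :> R by rewrite sumr_const card_ord.
set w1 := W _; set w2 := W _; set w3 := W E; set w4 := W d; set w5 := W _.
have -> : M%:R * (4 * c * N%:R ^+ 2 * (3 * w1 + 1)
    + 2 * (lambda * N%:R + 3 * (9 * w2 + N%:R ^+ 2 * w3 + 1) / lambda)
    + 4 * N%:R ^+ 2 + x * (18 * w4 + 2)
    + 3 * (9 * w5 + N%:R ^+ 2 * w4 + 1) / x) =
  4 * c * N%:R ^+ 2 * (3 * (M%:R * w1) + M%:R)
    + 2 * (lambda * (M%:R * N%:R) +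
           3 * (9 * (M%:R * w2) + N%:R ^+ 2 * (M%:R * w3) + M%:R) / lambda)
    + 4 * N%:R ^+ 2 * M%:R + x * (18 * (M%:R * w4) + 2 * M%:R)
    + 3 * (9 * (M%:R * w5) + N%:R ^+ 2 * (M%:R * w4) + M%:R) / x.
  by field; rewrite !gt_eqF.
have pw (j : 'I_M) := spectral_pointwise (normc_prim_root M0 wM j)
  r0 r1 rN c0 x0 l0 a01 b01 rT TrT bE bd tail.
(* The window is generalized because it is itself a sum, which the distribution
   of the products over the sums below would open. *)
rewrite !WE NE ME; move: (window R N) pw => B pw.
do 6!rewrite ?(mulr_sumr, mulr_suml) -?big_split /=.
by apply: ler_sum => j _; rewrite !mulr1; exact: pw.
Qed.

(** * Geometric weights *)

(** The generating polynomials are taken at radius [damping x ^ 4]. The spare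
    powers absorb factors [n], each at the cost of a factor [x]
    ([nat_mul_damping_le]). *)
Definition damping (R : rcfType) (x : R) : R := 1 - x^-1.

Lemma damping_ge0 (R : rcfType) (x : R) : 1 <= x -> 0 <= damping x.
Proof. by move=> x1; rewrite subr_ge0 invf_le1//; lra. Qed.

Lemma damping_le1 (R : rcfType) (x : R) : 1 <= x -> damping x <= 1.
Proof. by move=> x1; rewrite gerBl invr_ge0; lra. Qed.

Lemma sum_damping_le (R : rcfType) (x : R) n : 1 <= x ->
  \sum_(i < n) damping x ^+ i <= x.
Proof.
move=> x1; have x0 : 0 < x by lra.
have q0 := damping_ge0 x1.
have : damping x ^+ n - 1 = - x^-1 * \sum_(i < n) damping x ^+ i.
  by rewrite subrX1 /damping; congr (_ * _); ring.
move/(congr1 ( *%R (- x))); rewrite mulrA mulrNN divff ?gt_eqF// mul1r => <-.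
have : 0 <= x * damping x ^+ n by rewrite mulr_ge0 ?exprn_ge0// ltW.
lra.
Qed.

Lemma nat_mul_damping_le (R : rcfType) (x : R) n : 1 <= x -> n%:R * damping x ^+ n <= x.
Proof.
move=> x1; apply: le_trans (sum_damping_le n x1).
rewrite mulr_natl -[X in _ *+ X]card_ord -sumr_const ler_sum// => i _.
by rewrite ler_wiXn2l ?damping_ge0 ?damping_le1// ltnW.
Qed.

Lemma bernoulli_le (R : rcfType) (t : R) n : 0 <= t <= 1 -> 1 - n%:R * t <= (1 - t) ^+ n.
Proof.
move=> /andP[t0 t1]; elim: n => [|n IH]; first by rewrite expr0 mul0r subr0.
rewrite exprS -natr1.
have h : (1 - t) * (1 - n%:R * t) <= (1 - t) * (1 - t) ^+ n by rewrite ler_wpM2l//; lra.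
apply: le_trans h; have : 0 <= n%:R * t * t by rewrite !mulr_ge0.
move: (n%:R) => m; nra.
Qed.

(** Bernoulli's inequality is useless at the exponent [x], where it gives 0;
    at half of it, it gives 1/2, which is then squared. *)
Lemma damping_pow_ge (R : rcfType) (h : nat) : (0 < h)%N ->
  1 / 4 <= damping ((h.*2)%:R : R) ^+ (h.*2).
Proof.
move=> h0; set x : R := (h.*2)%:R.
have hR : 1 <= h%:R :> R by rewrite ler1n.
have x2 : x = 2 * h%:R by rewrite /x -mul2n natrM.
have t01 : 0 <= x^-1 <= 1.
  by rewrite invr_ge0 invf_le1 ?x2; lra.
have := bernoulli_le h t01; rewrite -/(damping x).
have -> : h%:R * x^-1 = 1 / 2 by rewrite x2; field; rewrite gt_eqF//; lra.
rewrite -muln2 exprM; move: (damping x ^+ h) => y yh; nra.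
Qed.

(** One quantity bounds the norms of [e] and of [n e n]; the exponent leaves two
    factors [damping x ^ n], one to absorb the growth of [e n ^ 2] and one to
    sum over [n]. *)
Definition energy (R : rcfType) (x : R) T (e : nat -> R) :=
  \sum_(n < T) e n ^+ 2 * damping x ^+ (2 * n).

Lemma sqnorm_le_energy (R : rcfType) (x : R) T e : 1 <= x ->
  sqnorm T (damping x ^+ 4) e <= energy x T e.
Proof.
move=> x1; apply: ler_sum => n _; rewrite exprMn -!exprM ler_wpM2l ?sqr_ge0//.
rewrite ler_wiXn2l ?damping_ge0 ?damping_le1//; lia.
Qed.

Lemma sqnorm_nat_le_energy (R : rcfType) (x : R) T e : 1 <= x ->
  sqnorm T (damping x ^+ 4) (fun n => n%:R * e n) <= x ^+ 2 * energy x T e.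
Proof.
move=> x1; rewrite /energy mulr_sumr; apply: ler_sum => n _.
have q0 := damping_ge0 x1; have q1 := damping_le1 x1.
have -> : (n%:R * e n * (damping x ^+ 4) ^+ n) ^+ 2 =
   (n%:R * damping x ^+ n) ^+ 2 * (e n ^+ 2 * damping x ^+ (6 * n)).
  by rewrite -exprM ![(_ * n)%N]mulnC !exprM; ring.
apply: ler_pM; rewrite ?sqr_ge0//.
- by apply: mulr_ge0; rewrite ?sqr_ge0 ?exprn_ge0.
- by rewrite lerXn2r ?nnegrE ?mulr_ge0 ?exprn_ge0 ?nat_mul_damping_le//; lra.
- by rewrite ler_wpM2l ?sqr_ge0// ler_wiXn2l//; lia.
Qed.

Lemma sqnorm1_le (R : rcfType) (x : R) T : 1 <= x ->
  sqnorm T (damping x ^+ 4) (fun=> 1) <= x.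
Proof.
move=> x1; apply: le_trans (sum_damping_le T x1); apply: ler_sum => n _.
rewrite mul1r -!exprM ler_wiXn2l ?damping_ge0 ?damping_le1//; lia.
Qed.

Lemma energy_pointwise (R : rcfType) (x eps C : R) T (e : nat -> R) :
  1 <= x -> 0 <= eps -> 0 <= C ->
  (forall n, e n ^+ 2 <= eps * Num.sqrt n%:R + C) ->
  energy x T e <= (eps * Num.sqrt x + C) * x.
Proof.
move=> x1 eps0 C0 he; have q0 := damping_ge0 x1; have q1 := damping_le1 x1.
apply: (@le_trans _ _ ((eps * Num.sqrt x + C) * \sum_(n < T) damping x ^+ n)); last first.
  rewrite ler_wpM2l ?sum_damping_le//.
  by rewrite addr_ge0// mulr_ge0// sqrtr_ge0.
rewrite mulr_sumr; apply: ler_sum => n _.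
have qn0 : 0 <= damping x ^+ n by exact: exprn_ge0.
have qn1 : damping x ^+ n <= 1 by exact: exprn_ile1.
rewrite mulnC exprM expr2 mulrA ler_wpM2r//.
apply: (@le_trans _ _ ((eps * Num.sqrt n%:R + C) * damping x ^+ n)).
  by rewrite ler_wpM2r ?he.
rewrite mulrDl lerD//; last by rewrite ler_piMr.
rewrite -mulrA ler_wpM2l//.
rewrite -[leLHS]ger0_norm ?mulr_ge0 ?sqrtr_ge0// -sqrtr_sqr ler_sqrt; last lra.
rewrite exprMn sqr_sqrtr// expr2 mulrA (le_trans _ (nat_mul_damping_le n x1))//.
by rewrite ler_piMr// mulr_ge0.
Qed.

(** Summation by parts against a geometric weight: it converts a bound on the
    averages of [f] into a bound on its weighted sum. *)
Lemma abel_geom (R : rcfType) (rho : R) (f : nat -> R) T :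
  \sum_(n < T) f n * rho ^+ n =
  (1 - rho) * (\sum_(n < T) (\sum_(i < n.+1) f i) * rho ^+ n)
  + (\sum_(i < T) f i) * rho ^+ T.
Proof.
elim: T => [|T IH]; first by rewrite !big_ord0; ring.
rewrite big_ord_recr /= IH [X in _ = _ * X + _]big_ord_recr /= [\sum_(i < T.+1) f i]big_ord_recr /=.
rewrite exprS; move: (\sum_(i < T) f i) (f T) => s t; ring.
Qed.

Lemma energy_average (R : rcfType) (x eps C : R) T (e : nat -> R) :
  1 <= x -> 0 <= eps -> 0 <= C ->
  (forall y : nat, \sum_(n < y.+1) e n ^+ 2 <= eps * y%:R + C) ->
  energy x T e <= 3 * (eps * x + C).
Proof.
move=> x1 eps0 C0 he; have q0 := damping_ge0 x1; have q1 := damping_le1 x1.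
have eC0 : 0 <= eps * x + C by rewrite addr_ge0 ?mulr_ge0//; lra.
have bd n : (eps * n%:R + C) * damping x ^+ n <= eps * x + C.
  rewrite mulrDl lerD//.
    by rewrite -mulrA ler_wpM2l// nat_mul_damping_le.
  by rewrite ler_piMr// exprn_ile1.
rewrite /energy; under eq_bigr => n _ do rewrite exprM.
rewrite (abel_geom _ (fun n => e n ^+ 2)) [leRHS](_ : _ = 2 * (eps * x + C) + (eps * x + C)); last ring.
rewrite lerD//.
  have -> : 1 - damping x ^+ 2 = x^-1 * (1 + damping x) by rewrite /damping; ring.
  apply: (@le_trans _ _ (x^-1 * (1 + damping x) * ((eps * x + C) * x))).
    rewrite ler_wpM2l//.
      by rewrite mulr_ge0 ?invr_ge0; lra.
    apply: (@le_trans _ _ ((eps * x + C) * \sum_(n < T) damping x ^+ n)).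
      rewrite mulr_sumr; apply: ler_sum => n _.
      rewrite -exprM mulnC exprM expr2 mulrA ler_wpM2r ?exprn_ge0//.
      by apply: le_trans (bd n); rewrite ler_wpM2r ?he ?exprn_ge0.
    by rewrite ler_wpM2l// sum_damping_le.
  have -> : x^-1 * (1 + damping x) * ((eps * x + C) * x) =
      (1 + damping x) * (eps * x + C) by field; rewrite gt_eqF//; lra.
  by rewrite ler_wpM2r//; lra.
case: T => [|T]; first by rewrite big_ord0 mul0r.
apply: le_trans (bd T); apply: ler_pM; rewrite ?exprn_ge0 ?he//.
  by apply: sumr_ge0 => i _; exact: sqr_ge0.
by rewrite -exprM ler_wiXn2l//; lia.
Qed.

(** Since [n ^ 4 * r ^ n <= x ^ 4] for every [n], all the truncation terms, which
    involve at most [n ^ 3], fall below 1 once [n] exceeds a multiple of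
    [N x ^ 4]. *)
Lemma cutoff_exists (R : realType) (x : R) (N : nat) (C : R) :
  1 <= x -> (0 < N)%N -> 0 <= C -> forall m : nat,
  let r := damping x ^+ 4 in
  exists T : nat, [/\ (m <= T)%N, r ^+ T.+1 <= 1 / 2, T.+1%:R * r ^+ T.+1 <= 1,
    forall e : R, `|e| <= C * T.+1%:R ^+ 2 -> N%:R * (T.+1%:R * (`|e| * r ^+ T.+1)) <= 1 &
    \sum_(n < T.+1.*2 | (T.+1 <= n)%N) n%:R * (n.+1%:R * r ^+ n) <= 1].
Proof.
move=> x1 N0 C0 m r.
have q0 := damping_ge0 x1; have q1 := damping_le1 x1.
have r0 n : 0 <= r ^+ n by rewrite exprn_ge0 ?exprn_ge0.
have rn n : n%:R ^+ 4 * r ^+ n <= x ^+ 4.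
  rewrite /r -exprM mulnC exprM -exprMn lerXn2r ?nnegrE ?mulr_ge0 ?exprn_ge0 ?nat_mul_damping_le//; lra.
have N1 : 1 <= N%:R :> R by rewrite ler1n.
pose K := 4 * (1 + C) * N%:R * x ^+ 4.
pose T := maxn m (Num.bound K); exists T.
have Tm : (m <= T)%N by exact: leq_maxl.
set t : R := T.+1%:R.
have tK : K <= t.
  have K0 : 0 <= K by rewrite /K !mulr_ge0 ?exprn_ge0//; lra.
  apply: (le_trans (ltW (archi_boundP K0))).
  by rewrite /t ler_nat; apply: leqW; exact: leq_maxr.
have t1 : 1 <= t by rewrite ler1n.
have x41 : 1 <= x ^+ 4 by rewrite exprn_ege1.
have Kx : 4 * x ^+ 4 <= K.
  rewrite /K ler_wpM2r ?exprn_ge0//; first lra.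
  rewrite -mulrA ler_peMr//; nra.
have := rn T.+1; rewrite -/t; set rho := r ^+ T.+1 => trho.
have t3 : (4 * (1 + C) * N%:R) * (t ^+ 3 * rho) <= 1.
  have x40 : 0 < x ^+ 4 by lra.
  rewrite -(ler_pM2r x40) mul1r; apply: le_trans trho.
  have -> : 4 * (1 + C) * N%:R * (t ^+ 3 * rho) * x ^+ 4 = K * (t ^+ 3 * rho) by rewrite /K; ring.
  have -> : t ^+ 4 * rho = t * (t ^+ 3 * rho) by ring.
  by rewrite ler_wpM2r// mulr_ge0 ?exprn_ge0 ?r0//; lra.
have rho0 : 0 <= rho by exact: r0.
have t30 : 0 <= t ^+ 3 * rho by rewrite mulr_ge0 ?exprn_ge0//; lra.
have t3' : 4 * (t ^+ 3 * rho) <= 1.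
  apply: le_trans t3; rewrite ler_wpM2r// -mulrA ler_peMr//; nra.
have t21 : 1 <= t ^+ 2 by rewrite exprn_ege1.
have tt : t * rho <= t ^+ 3 * rho.
  have -> : t ^+ 3 * rho = t ^+ 2 * (t * rho) by ring.
  by rewrite ler_peMl// mulr_ge0//; lra.
have tr : rho <= t * rho by rewrite ler_peMl.
split => //; [lra | lra | |].
  move=> e he.
  have : N%:R * (t * (`|e| * rho)) <= N%:R * (t * (C * t ^+ 2 * rho)).
    by rewrite !ler_wpM2l// ?ler_wpM2r//; lra.
  move/le_trans; apply; apply: le_trans t3.
  have -> : N%:R * (t * (C * t ^+ 2 * rho)) = C * N%:R * (t ^+ 3 * rho) by ring.
  by rewrite ler_wpM2r// ler_wpM2r//; lra.
apply: (@le_trans _ _ (\sum_(n < T.+1.*2) 2 * x ^+ 4 / t ^+ 2)).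
  rewrite [leRHS](bigID (fun n : 'I__ => (T.+1 <= n)%N)) /= ler_wpDr//.
    by rewrite sumr_ge0// => i _; rewrite divr_ge0 ?mulr_ge0 ?exprn_ge0//; lra.
  apply: ler_sum => n Tn.
  have tn : t <= n%:R by rewrite ler_nat.
  have n1 : 1 <= n%:R :> R by lra.
  rewrite ler_pdivlMr ?exprn_gt0//.
  apply: (@le_trans _ _ (2 * (n%:R ^+ 4 * r ^+ n))); last by rewrite ler_wpM2l ?rn.
  have -> : n%:R * (n.+1%:R * r ^+ n) * t ^+ 2 = (n%:R * n.+1%:R * t ^+ 2) * r ^+ n by ring.
  rewrite mulrA ler_wpM2r//.
  have h : n%:R * n.+1%:R <= 2 * n%:R ^+ 2 :> R.
    by rewrite -natr1; move: (n%:R : R) n1 => y y1; nra.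
  have -> : 2 * n%:R ^+ 4 = (2 * n%:R ^+ 2) * n%:R ^+ 2 :> R by ring.
  by rewrite ler_pM ?mulr_ge0 ?exprn_ge0 ?lerXn2r ?nnegrE//; lra.
rewrite sumr_const card_ord -[_ *+ _]mulr_natr -muln2 natrM -/t.
have -> : 2 * x ^+ 4 / t ^+ 2 * (t * 2) = 4 * x ^+ 4 / t by field; rewrite gt_eqF//; lra.
by rewrite ler_pdivrMr ?mul1r//; lra.
Qed.

(** * Growth of the counting functions *)

Definition psum (R : rcfType) (a : nat -> R) n : R := \sum_(i < n.+1) a i.

Lemma psumS (R : rcfType) (a : nat -> R) n : psum a n.+1 = psum a n + a n.+1.
Proof. by rewrite /psum big_ord_recr. Qed.

Lemma psum_ge0 (R : rcfType) (a : nat -> R) n : (forall i, 0 <= a i) -> 0 <= psum a n.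
Proof. by move=> a0; exact: sumr_ge0. Qed.

Lemma psum_le (R : rcfType) (a : nat -> R) m n : (forall i, 0 <= a i) ->
  (m <= n)%N -> psum a m <= psum a n.
Proof.
move=> a0 /subnK <-; elim: (n - m)%N => [|k IH]; first by rewrite add0n.
by rewrite addSn psumS (le_trans IH)// lerDl.
Qed.

Lemma psum_convolution (R : rcfType) (a b : nat -> R) n :
  psum (convolution a b) n = \sum_(i < n.+1) a i * psum b (n - i).
Proof.
elim: n => [|n IH]; first by rewrite /psum /convolution !big_ord1.
rewrite psumS IH /convolution [X in _ + X]big_ord_recr [RHS]big_ord_recr /= addrA -big_split /=.
rewrite subnn (_ : psum b 0 = b 0%N); last by rewrite /psum big_ord1.
congr (_ + _); apply: eq_bigr => i _.
by rewrite -mulrDr subSn ?psumS// -ltnS.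
Qed.

Lemma psum_convolution_le (R : rcfType) (a b : nat -> R) n :
  (forall i, 0 <= a i) -> (forall i, 0 <= b i) ->
  psum (convolution a b) n <= psum a n * psum b n.
Proof.
move=> a0 b0; rewrite psum_convolution /psum mulr_suml ler_sum// => i _.
by rewrite ler_wpM2l// -/(psum b (n - i)) -/(psum b n) psum_le// leq_subr.
Qed.

Lemma psum_convolution_ge (R : rcfType) (a b : nat -> R) n :
  (forall i, 0 <= a i) -> (forall i, 0 <= b i) ->
  psum a n * psum b n <= psum (convolution a b) n.*2.
Proof.
move=> a0 b0; rewrite psum_convolution.
have nn : (n.+1 <= n.*2.+1)%N by rewrite ltnS -addnn leq_addr.
rewrite {1}/psum mulr_suml (big_ord_widen _ (fun i => a i * psum b n) nn).
rewrite big_mkcond /=; apply: ler_sum => i _; case: ltnP => [lin|_].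
  by rewrite ler_wpM2l// psum_le//; lia.
by rewrite mulr_ge0 ?psum_ge0.
Qed.

Lemma abs_le_sqr1 (R : rcfType) (t : R) : `|t| <= t ^+ 2 + 1.
Proof. by have := sqr_ge0 (`|t| - 1); rewrite sqrrB real_normK ?num_real//; have := normr_ge0 t; lra. Qed.

(** In [psum (a + b) n ^ 2 = 4 (psum a n) (psum b n) + (count_diff a b n) ^ 2] the
    product is at least the sum of the convolution up to [n] and at most its
    sum up to [2 n]. So [psum (a + b)] is at most [3 sqrt c z] at [z ^ 2] and at
    least [7 sqrt c z] at [16 z ^ 2]: a fixed proportion of the mass lies between
    the two. *)
Lemma psum_increment (R : realType) (a b : nat -> R) (c C1 C2 : R) :
  (forall i, 0 <= a i) -> (forall i, 0 <= b i) -> 0 < c ->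
  (forall n, sum_err a b c n ^+ 2 <= Num.sqrt n%:R + C1) ->
  (forall n, count_diff a b n ^+ 2 <= c / 2 * n%:R + C2) ->
  forall z : nat, 1 <= z%:R :> R ->
  2 * (4 * c + 12 + 4 * C1 + C2) <= c * z%:R :> R ->
  20 + 4 * C1 <= c * z%:R :> R ->
  4 * Num.sqrt c * z%:R <= psum (fun n => a n + b n) (16 * z ^ 2)%N
                           - psum (fun n => a n + b n) (z ^ 2)%N.
Proof.
move=> a0 b0 c0 hE hd z z1 zb zb'; set u := fun n => _.
set Z : R := z%:R in z1 zb zb' *.
have u0 i : 0 <= u i by rewrite addr_ge0.
have s2 : Num.sqrt c ^+ 2 = c by rewrite sqr_sqrtr// ltW.
have s0 := sqrtr_ge0 c.
have Rn n : psum (convolution a b) n = c * n.+1%:R + sum_err a b c n.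
  by rewrite /sum_err -/(psum _ n); move: (psum _ n) => p; ring.
have uE n : psum u n ^+ 2 = 4 * (psum a n * psum b n) + count_diff a b n ^+ 2.
  rewrite /count_diff sumrB -/(psum a n) -/(psum b n).
  have -> : psum u n = psum a n + psum b n by rewrite /psum big_split.
  by move: (psum a n) (psum b n) => s t; ring.
have Ebd n : `|sum_err a b c n| <= Num.sqrt n%:R + C1 + 1.
  by rewrite (le_trans (abs_le_sqr1 _))// lerD2r.
have ZZ : Z <= Z ^+ 2 by rewrite expr2 ler_peMr//; lra.
have sq m (M : R) : 0 <= M -> m%:R <= M ^+ 2 -> Num.sqrt m%:R <= M.
  by move=> M0 mM; rewrite -[leRHS]ger0_norm// -sqrtr_sqr ler_sqrt// exprn_ge0.
have lo : 7 * Num.sqrt c * Z <= psum u (16 * z ^ 2)%N.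
  rewrite -ler_sqr ?nnegrE ?psum_ge0 ?mulr_ge0//; try lra.
  have -> : (7 * Num.sqrt c * Z) ^+ 2 = 49 * c * Z ^+ 2 by rewrite -{2}s2; ring.
  rewrite uE; apply: ler_wpDr; first exact: sqr_ge0.
  have s4 : Num.sqrt (16 * z ^ 2)%:R <= 4 * Z.
    by apply: sq; [lra | rewrite natrM natrX -/Z exprMn; lra].
  have := Ebd (16 * z ^ 2)%N; rewrite ler_norml => /andP[e1 _].
  have := psum_convolution_le (16 * z ^ 2) a0 b0; rewrite Rn -natr1 natrM natrX -/Z.
  have : (20 + 4 * C1) * Z <= c * Z * Z by rewrite ler_wpM2r//; lra.
  have : 4 * C1 <= 4 * C1 * Z.
    rewrite ler_peMr//; have := hE 0%N; rewrite sqrtr0; have := sqr_ge0 (sum_err a b c 0); lra.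
  have : 0 <= c * Z ^+ 2 by rewrite mulr_ge0 ?sqr_ge0//; lra.
  have -> : c * Z * Z = c * Z ^+ 2 by ring.
  move: (psum a _ * psum b _) (sum_err a b c _) e1 => p e.
  have -> : c * (16 * Z ^+ 2 + 1) = 16 * (c * Z ^+ 2) + c by ring.
  have -> : 49 * c * Z ^+ 2 = 49 * (c * Z ^+ 2) by ring.
  move: (c * Z ^+ 2) (Num.sqrt _) s4 => w y s4' e1.
  lra.
have hi : psum u (z ^ 2)%N <= 3 * Num.sqrt c * Z.
  rewrite -ler_sqr ?nnegrE ?psum_ge0 ?mulr_ge0//; try lra.
  have -> : (3 * Num.sqrt c * Z) ^+ 2 = 9 * c * Z ^+ 2 by rewrite -{2}s2; ring.
  rewrite uE; have := psum_convolution_ge (z ^ 2) a0 b0; rewrite Rn.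
  rewrite -[_.*2.+1%:R]natr1 -muln2 natrM natrX -/Z.
  have := Ebd (z ^ 2 * 2)%N; rewrite ler_norml => /andP[_ e1].
  have s4 : Num.sqrt (z ^ 2 * 2)%:R <= 2 * Z.
    by apply: sq; [lra | rewrite natrM natrX -/Z exprMn; have := sqr_ge0 Z; lra].
  have := hd (z ^ 2)%N; rewrite natrX -/Z.
  have : 2 * (4 * c + 12 + 4 * C1 + C2) * Z <= c * Z * Z by rewrite ler_wpM2r//; lra.
  have C10 : 0 <= C1.
    have := hE 0%N; rewrite sqrtr0; have := sqr_ge0 (sum_err a b c 0); lra.
  have C20 : 0 <= C2.
    have := hd 0%N; rewrite mulr0; have := sqr_ge0 (count_diff a b 0); lra.
  have -> : c * Z * Z = c * Z ^+ 2 by ring.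
  have : 4 * c + 4 * C1 + 4 + C2 <= (4 * c + 4 * C1 + 4 + C2) * Z.
    by rewrite ler_peMr//; lra.
  have : 0 <= c * Z ^+ 2 by rewrite mulr_ge0 ?sqr_ge0//; lra.
  move: (psum a _ * psum b _) (sum_err a b c _) e1 => p e.
  move: (Num.sqrt _) s4 => y s4' e1.
  move: (count_diff a b _ ^+ 2) => dd.
  have -> : c * (Z ^+ 2 * 2 + 1) = 2 * (c * Z ^+ 2) + c by ring.
  have -> : 9 * c * Z ^+ 2 = 9 * (c * Z ^+ 2) by ring.
  have -> : c / 2 * Z ^+ 2 = (c * Z ^+ 2) / 2 by field.
  move: (c * Z ^+ 2) => w.
  lra.
lra.
Qed.

(** * Choice of the parameters *)

(** The indices between [z ^ 2] and [x = 16 z ^ 2] suffice: there [m >= z ^ 2]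
    and the weight is at least [damping x ^ (8 x) >= 4 ^ -8]. The coefficients
    [a m + b m] are integers, hence at most their squares. *)
Lemma diagonal_sum_ge (R : realType) (a b : nat -> R) (z T : nat) (S : R) :
  (forall i, 0 <= a i) -> (forall i, 0 <= b i) ->
  (forall i, a i + b i <= (a i + b i) ^+ 2) -> (0 < z)%N ->
  (16 * z ^ 2 <= T)%N ->
  S <= psum (fun n => a n + b n) (16 * z ^ 2)%N - psum (fun n => a n + b n) (z ^ 2)%N ->
  z%:R ^+ 2 * S / 4 ^+ 8 <=
  \sum_(m < T.+1) (a m + b m) * (m%:R * (a m + b m)) *
    (damping (16 * z ^ 2)%N%:R ^+ 4) ^+ (2 * m).
Proof.
move=> a0 b0 u1 z0 zT HS.
set x := (16 * z ^ 2)%N in zT HS *; set r := damping _ ^+ 4.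
pose u n := a n + b n; have u0 n : 0 <= u n by rewrite addr_ge0.
have z2 : (0 < z ^ 2)%N by rewrite expn_gt0 z0.
have x1 : 1 <= x%:R :> R by rewrite ler1n /x; lia.
have q0 := damping_ge0 x1; have q1 := damping_le1 x1.
have qx : 1 / 4 <= damping (R := R) x%:R ^+ x.
  have -> : x = (8 * z ^ 2).*2 by rewrite /x -muln2; lia.
  by apply: damping_pow_ge; lia.
have q8 : 1 / 4 ^+ 8 <= (damping (R := R) x%:R ^+ x) ^+ 8.
  have -> : 1 / 4 ^+ 8 = (1 / 4) ^+ 8 :> R by field.
  by rewrite lerXn2r ?nnegrE ?exprn_ge0//; lra.
have Tn : (x.+1 <= T.+1)%N by [].
have r0 : 0 <= r by exact: exprn_ge0.
apply: (@le_trans _ _ (\sum_(m < x.+1) if (z ^ 2 < m)%N then z%:R ^+ 2 / 4 ^+ 8 * u m else 0)).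
  rewrite [leLHS](_ : _ = z%:R ^+ 2 / 4 ^+ 8 * S); last by field.
  apply: (@le_trans _ _ (z%:R ^+ 2 / 4 ^+ 8 * (psum u x - psum u (z ^ 2)%N))).
    by rewrite ler_wpM2l// mulr_ge0 ?exprn_ge0//; lra.
  have zx : ((z ^ 2).+1 <= x.+1)%N by rewrite /x; lia.
  rewrite /psum (big_ord_widen _ u zx) [X in _ * (_ - X)]big_mkcond -sumrB mulr_sumr.
  apply: ler_sum => m _; rewrite ltnS; case: ltnP => zm; last by rewrite subrr mulr0.
  by rewrite subr0.
rewrite (big_ord_widen _ (fun m => if (z ^ 2 < m)%N then z%:R ^+ 2 / 4 ^+ 8 * u m else 0) Tn).
rewrite big_mkcond; apply: ler_sum => m _ /=.
have p0 : 0 <= u m * (m%:R * u m) * r ^+ (2 * m).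
  by rewrite !mulr_ge0 ?exprn_ge0.
case: ifP => // mx; case: ifP => // zm.
have -> : u m * (m%:R * u m) * r ^+ (2 * m) = (m%:R * r ^+ (2 * m)) * u m ^+ 2 by ring.
apply: ler_pM => //; last exact: u1.
apply: ler_pM => //.
  by rewrite -natrX ler_nat ltnW.
have xm : (8 * m <= x * 8)%N by rewrite mulnC leq_mul2r.
rewrite /r -exprM mulnA; apply: le_trans (ler_wiXn2l q0 q1 xm).
by rewrite exprM -[X in X <= _]div1r.
Qed.

Lemma main_term_le (R : rcfType) (n k c W1 x : R) :
  0 <= c -> x = 16 * (k * n) ^+ 2 -> 1 <= x -> W1 <= x ->
  4 * c * n ^+ 2 * (3 * W1 + 1) <= 256 * c * k ^+ 2 * n ^+ 4.
Proof.
move=> c0 xE x1 hW.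
apply: (@le_trans _ _ (4 * c * n ^+ 2 * (4 * x))).
  apply: ler_wpM2l; last by clear - x1 hW; lra.
  by rewrite mulr_ge0 ?sqr_ge0// mulr_ge0.
by rewrite xE le_eqVlt; apply/orP; left; apply/eqP; ring.
Qed.

Lemma weighted_sum_le (R : rcfType) (n x P W Wn : R) :
  n ^+ 2 <= x ^+ 2 -> 0 <= P -> W <= P -> Wn <= x ^+ 2 * P ->
  9 * Wn + n ^+ 2 * W + 1 <= 10 * (x ^+ 2 * P) + 1.
Proof.
move=> nx P0 hW hWn.
have : n ^+ 2 * W <= x ^+ 2 * P.
  apply: (@le_trans _ _ (n ^+ 2 * P)); first by rewrite ler_wpM2l ?sqr_ge0.
  by rewrite ler_wpM2r.
by clear - hWn; lra.
Qed.

(** The choice [lambda = n ^ 3] gives the first term the order [n ^ 4] of the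
    contradiction, and [e1] is small enough in terms of [k] for the leading part
    of the others to have that order too. *)
Lemma sum_err_terms_le (R : rcfType) (n k C1 e1 P W Wn x : R) :
  1 <= n -> x = 16 * (k * n) ^+ 2 -> n ^+ 2 <= x ^+ 2 ->
  240 * 4 ^+ 6 * k ^+ 7 * e1 = 1 ->
  0 <= P -> W <= P -> Wn <= x ^+ 2 * P -> P <= (e1 * (4 * (k * n)) + C1) * x ->
  2 * (n ^+ 3 * n + 3 * (9 * Wn + n ^+ 2 * W + 1) / n ^+ 3) <=
    3 * n ^+ 4 + 60 * 4 ^+ 6 * k ^+ 6 * C1 * n ^+ 3 + 6.
Proof.
move=> n1 xE nx he P0 hW hWn hP.
have n3 : 1 <= n ^+ 3 by rewrite exprn_ege1.
have n30 : 0 < n ^+ 3 by exact: lt_le_trans n3.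
have h1 : 3 * (9 * Wn + n ^+ 2 * W + 1) / n ^+ 3 <= 30 * (x ^+ 2 * P) / n ^+ 3 + 3.
  have h : 3 * (9 * Wn + n ^+ 2 * W + 1) <= 30 * (x ^+ 2 * P) + 3.
    by have := weighted_sum_le nx P0 hW hWn; clear; lra.
  rewrite ler_pdivrMr// [leRHS]mulrDl divfK ?gt_eqF// (le_trans h)// lerD2l.
  by clear - n3; lra.
have h2 : 30 * (x ^+ 2 * P) / n ^+ 3 <= n ^+ 4 / 2 + 30 * 4 ^+ 6 * k ^+ 6 * C1 * n ^+ 3.
  apply: (@le_trans _ _ (30 * (x ^+ 2 * ((e1 * (4 * (k * n)) + C1) * x)) / n ^+ 3)).
    by rewrite ler_wpM2r ?invr_ge0 ?(ltW n30)// ler_wpM2l// ler_wpM2l ?sqr_ge0.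
  have -> : n ^+ 4 = 240 * 4 ^+ 6 * k ^+ 7 * e1 * n ^+ 4 by rewrite he mul1r.
  rewrite xE le_eqVlt; apply/orP; left; apply/eqP; field.
  by rewrite gt_eqF// (lt_le_trans ltr01 n1).
rewrite -exprSr; clear - h1 h2; lra.
Qed.

Lemma count_diff_terms_le (R : rcfType) (n k C2 e2 P W Wn x : R) :
  1 <= x -> x = 16 * (k * n) ^+ 2 -> n ^+ 2 <= x ^+ 2 ->
  144 * 4 ^+ 4 * k ^+ 4 * e2 = 1 ->
  0 <= P -> W <= P -> Wn <= x ^+ 2 * P -> P <= 3 * (e2 * x + C2) ->
  x * (18 * W + 2) + 3 * (9 * Wn + n ^+ 2 * W + 1) / x <=
    n ^+ 4 + 144 * 4 ^+ 2 * k ^+ 2 * C2 * n ^+ 2 + 2 * x + 3.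
Proof.
move=> x1 xE nx he P0 hW hWn hP; have x0 : 0 < x by exact: lt_le_trans x1.
have h1 : x * (18 * W + 2) <= 18 * (x * P) + 2 * x.
  have : x * W <= x * P by rewrite ler_wpM2l// ltW.
  by clear; lra.
have h2 : 3 * (9 * Wn + n ^+ 2 * W + 1) / x <= 30 * (x * P) + 3.
  rewrite ler_pdivrMr//; have -> : (30 * (x * P) + 3) * x = 30 * (x ^+ 2 * P) + 3 * x by ring.
  by have := weighted_sum_le nx P0 hW hWn; clear - x1; lra.
have h3 : 48 * (x * P) <= n ^+ 4 + 144 * 4 ^+ 2 * k ^+ 2 * C2 * n ^+ 2.
  apply: (@le_trans _ _ (48 * (x * (3 * (e2 * x + C2))))).
    by rewrite ler_wpM2l// ler_wpM2l// ltW.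
  have -> : n ^+ 4 = 144 * 4 ^+ 4 * k ^+ 4 * e2 * n ^+ 4 by rewrite he mul1r.
  by rewrite xE le_eqVlt; apply/orP; left; apply/eqP; ring.
clear - h1 h2 h3; lra.
Qed.

Lemma diagonal_term_ge (R : rcfType) (n k c s S : R) :
  0 <= n -> 4 ^+ 8 * (256 * c + 6) <= 8 * (s * k) ->
  (k * n) ^+ 2 * (4 * s * (k * n)) / 4 ^+ 8 <= S ->
  256 * c * k ^+ 2 * n ^+ 4 + 6 * (k ^+ 2 * n ^+ 4) <= 2 * (n * S).
Proof.
move=> n0 hk hS.
apply: (@le_trans _ _ (2 * (n * ((k * n) ^+ 2 * (4 * s * (k * n)) / 4 ^+ 8)))); last first.
  by rewrite ler_wpM2l// ler_wpM2l.
have -> : 2 * (n * ((k * n) ^+ 2 * (4 * s * (k * n)) / 4 ^+ 8)) =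
  8 * (s * k) / 4 ^+ 8 * (k ^+ 2 * n ^+ 4) by field.
have -> : 256 * c * k ^+ 2 * n ^+ 4 + 6 * (k ^+ 2 * n ^+ 4) =
  (256 * c + 6) * (k ^+ 2 * n ^+ 4) by ring.
apply: ler_wpM2r; first by rewrite mulr_ge0 ?sqr_ge0// exprn_ge0.
by rewrite ler_pdivlMr ?exprn_gt0// mulrC.
Qed.

(** The inequality on [L] follows from [diagonal_term_ge], where [k] has been
    taken large enough to turn a term in [k ^ 3] into one in [k ^ 2] whose
    coefficient exceeds that of the main term. What remains on the right has
    order [n ^ 4] with a coefficient less than 6, or lower order in [n]. *)
Lemma parameters_absurd (R : rcfType) (n k c x C1 C2 L T1 T2 T3 : R) :
  1 <= n -> 1 <= k -> 0 <= C2 -> x = 16 * (k * n) ^+ 2 ->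
  60 * 4 ^+ 6 * k ^+ 6 * C1 + 144 * 4 ^+ 2 * k ^+ 2 * C2 + 32 * k ^+ 2 + 13 <= n ->
  256 * c * k ^+ 2 * n ^+ 4 + 6 * (k ^+ 2 * n ^+ 4) <= L ->
  T1 <= 256 * c * k ^+ 2 * n ^+ 4 ->
  T2 <= 3 * n ^+ 4 + 60 * 4 ^+ 6 * k ^+ 6 * C1 * n ^+ 3 + 6 ->
  T3 <= n ^+ 4 + 144 * 4 ^+ 2 * k ^+ 2 * C2 * n ^+ 2 + 2 * x + 3 ->
  L <= T1 + T2 + 4 * n ^+ 2 + T3 -> False.
Proof.
move=> n1 k1 C20 xE hn hL hT1 hT2 hT3 hLT.
have n0 : 0 <= n by exact: le_trans n1.
have n3 : 1 <= n ^+ 3 by rewrite exprn_ege1.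
have n2 : n ^+ 2 <= n ^+ 3 by rewrite [leRHS]exprS ler_peMl ?sqr_ge0.
have n4 : 0 < n ^+ 4 by rewrite exprn_gt0// (lt_le_trans ltr01 n1).
have hn4 : (60 * 4 ^+ 6 * k ^+ 6 * C1 + 144 * 4 ^+ 2 * k ^+ 2 * C2 + 32 * k ^+ 2 + 13)
    * n ^+ 3 <= n ^+ 4 by rewrite [leRHS]exprS ler_wpM2r// exprn_ge0.
have r1 : 144 * 4 ^+ 2 * k ^+ 2 * C2 * n ^+ 2 <= 144 * 4 ^+ 2 * k ^+ 2 * C2 * n ^+ 3.
  by apply: ler_wpM2l => //; rewrite !mulr_ge0 ?exprn_ge0// (le_trans ler01 k1).
have r2 : 2 * x <= 32 * k ^+ 2 * n ^+ 3.
  have -> : 2 * x = 32 * k ^+ 2 * n ^+ 2 by rewrite xE; ring.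
  by rewrite ler_wpM2l// mulr_ge0 ?sqr_ge0.
have kn : n ^+ 4 <= k ^+ 2 * n ^+ 4 by rewrite ler_peMl ?(ltW n4)// exprn_ege1.
clear - n3 n2 n4 hn4 r1 r2 kn hL hT1 hT2 hT3 hLT; lra.
Qed.

Lemma energy_ge0 (R : rcfType) (x : R) T (e : nat -> R) : 1 <= x -> 0 <= energy x T e.
Proof.
move=> x1; apply: sumr_ge0 => n _.
by apply: mulr_ge0; rewrite ?sqr_ge0// exprn_ge0// damping_ge0.
Qed.

Lemma nat_above (R : realType) (y : R) : exists2 n : nat, (0 < n)%N & y <= n%:R.
Proof.
exists (Num.bound `|y|).+1 => //; rewrite (le_trans (ler_norm _))//.
by rewrite (le_trans (ltW (archi_boundP (normr_ge0 y))))// ler_nat.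
Qed.

Lemma inverse_scale (R : rcfType) (K : R) : 1 <= K ->
  exists e, [/\ 0 < e, e <= 1 & K * e = 1].
Proof.
move=> K1; have K0 : 0 < K by exact: lt_le_trans K1.
by exists K^-1; rewrite invr_gt0 invf_le1// divff ?gt_eqF.
Qed.

Lemma damping4_short_window (R : rcfType) (x n : R) :
  1 <= x -> 0 <= n -> 4 * n <= x -> (1 - damping x ^+ 4) * n <= 1.
Proof.
move=> x1 n0 nx; have x0 : 0 < x by exact: lt_le_trans x1.
have t01 : 0 <= x^-1 <= 1 by rewrite invr_ge0 (ltW x0) invf_le1.
have := bernoulli_le 4 t01; rewrite -/(damping x) => h.
apply: (@le_trans _ _ (4 / x * n)); first by rewrite ler_wpM2r//; clear - h; lra.
by rewrite mulrAC ler_pdivrMr// mul1r.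
Qed.

Lemma abs_le_of_sqr (R : rcfType) (e eps y C D t : R) :
  0 <= y -> eps <= 1 -> 0 <= C -> 0 <= D -> y <= t -> 1 <= t ->
  e ^+ 2 <= eps * y + C -> `|e| <= (2 + C + D) * t.
Proof.
move=> y0 eps1 C0 D0 yt t1 he; rewrite (le_trans (abs_le_sqr1 _))//.
have : eps * y <= 1 * y by rewrite ler_wpM2r.
have : C <= C * t by rewrite ler_peMr.
have : 0 <= D * t by rewrite mulr_ge0// (le_trans ler01 t1).
by clear - he yt t1; lra.
Qed.

(** The conclusion for two sets whose counting functions differ little in mean
    square. The parameters are chosen in the order [k], then the tolerances
    [e1] and [e2] in terms of [k], then [N] in terms of the constants that the
    hypotheses attach to these tolerances, and last the cutoff [T]. *)
Lemma no_sharp_asymptotic (R : realType) (a b : nat -> R) (c : R) :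
  (forall n, a n = 0 \/ a n = 1) -> (forall n, b n = 0 \/ b n = 1) -> 0 < c ->
  (forall eps, 0 < eps -> exists C, forall n,
     sum_err a b c n ^+ 2 <= eps * Num.sqrt n%:R + C) ->
  (forall eps, 0 < eps -> exists C, forall y : nat,
     \sum_(n < y.+1) count_diff a b n ^+ 2 <= eps * y%:R + C) ->
  False.
Proof.
move=> aE bE c0 hE hd.
have a01 n : 0 <= a n <= 1 by case: (aE n) => ->; rewrite ?lexx ?ler01.
have b01 n : 0 <= b n <= 1 by case: (bE n) => ->; rewrite ?lexx ?ler01.
have a0 n : 0 <= a n by case/andP: (a01 n).
have b0 n : 0 <= b n by case/andP: (b01 n).
have usq n : a n + b n <= (a n + b n) ^+ 2.
  by clear - aE bE; case: (aE n) => ->; case: (bE n) => ->; lra.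
have Cge0 (eps C : R) : (forall n, sum_err a b c n ^+ 2 <= eps * Num.sqrt n%:R + C) -> 0 <= C.
  by move=> /(_ 0%N); rewrite sqrtr0 mulr0 add0r; apply: le_trans; exact: sqr_ge0.
have Dge0 (eps C : R) : (forall y : nat, \sum_(n < y.+1) count_diff a b n ^+ 2 <= eps * y%:R + C) -> 0 <= C.
  by move=> /(_ 0%N); rewrite mulr0 add0r big_ord1; apply: le_trans; exact: sqr_ge0.
have dsq (eps C : R) : (forall y : nat, \sum_(n < y.+1) count_diff a b n ^+ 2 <= eps * y%:R + C) ->
    forall n, count_diff a b n ^+ 2 <= eps * n%:R + C.
  move=> h n; apply: le_trans (h n); rewrite big_ord_recr /= lerDr sumr_ge0// => i _.
  exact: sqr_ge0.
have s0 : 0 < Num.sqrt c by rewrite sqrtr_gt0.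
set s := Num.sqrt c in s0.
have [k kp kK] := nat_above (4 ^+ 8 * (256 * c + 6) / (8 * s)).
have k1 : 1 <= k%:R :> R by rewrite ler1n.
have hk : 4 ^+ 8 * (256 * c + 6) <= 8 * (s * k%:R).
  by move: kK; rewrite ler_pdivrMr ?mulr_gt0// => h; rewrite (le_trans h)// mulrC mulrA.
have pow1 (K : nat) i j : (0 < K)%N -> 1 <= K%:R * 4 ^+ i * k%:R ^+ j :> R.
  by move=> K0; rewrite -!natrX -!natrM ler1n !muln_gt0 K0 !expn_gt0 kp.
have [e1 [e10 e11 he1]] := inverse_scale (pow1 240%N 6%N 7%N isT).
have [e2 [e20 e21 he2]] := inverse_scale (pow1 144%N 4%N 4%N isT).
have [C1 hC1] := hE e1 e10; have C10 := Cge0 _ _ hC1.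
have [C2 hC2] := hd e2 e20; have C20 := Dge0 _ _ hC2.
have [C3 hC3] := hE 1 ltr01.
have [C4 hC4] := hd (c / 2) (divr_gt0 c0 (ltr0Sn R 1)).
have hC3' n : sum_err a b c n ^+ 2 <= Num.sqrt n%:R + C3 by rewrite -[Num.sqrt _]mul1r.
have [N Np] := nat_above (Num.max
   (60 * 4 ^+ 6 * k%:R ^+ 6 * C1 + 144 * 4 ^+ 2 * k%:R ^+ 2 * C2 + 32 * k%:R ^+ 2 + 13)
   (Num.max (2 * (4 * c + 12 + 4 * C3 + C4) / c) ((20 + 4 * C3) / c))).
rewrite !ge_max => /and3P[hn hN1 hN2].
have n1 : 1 <= N%:R :> R by rewrite ler1n.
pose z := (k * N)%N; have zp : (0 < z)%N by rewrite muln_gt0 kp.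
have zE : z%:R = k%:R * N%:R :> R by rewrite natrM.
have Nz : N%:R <= z%:R :> R by rewrite zE ler_peMl.
have cz (y : R) : y / c <= N%:R -> y <= c * z%:R.
  by rewrite ler_pdivrMr// mulrC => /le_trans; apply; rewrite ler_wpM2l// ltW.
have z1 : 1 <= z%:R :> R by rewrite ler1n.
have incr := psum_increment a0 b0 c0 hC3' (dsq _ _ hC4) z1 (cz _ hN1) (cz _ hN2).
rewrite -/s in incr.
pose xn := (16 * z ^ 2)%N; pose x : R := xn%:R.
have xE : x = 16 * (k%:R * N%:R) ^+ 2 by rewrite /x /xn natrM natrX zE.
have x1 : 1 <= x by rewrite ler1n /xn muln_gt0 expn_gt0 zp.
have x0 : 0 < x by exact: lt_le_trans x1.
have Nx : 16 * N%:R <= x by rewrite xE ler_wpM2l// -zE (le_trans Nz)// expr2 ler_peMr.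
have Nx4 : 4 * N%:R <= x by apply: le_trans Nx; rewrite ler_wpM2r// ler_nat.
have N2x2 : N%:R ^+ 2 <= x ^+ 2.
  by rewrite lerXn2r ?nnegrE ?(ltW x0)// (le_trans _ Nx4)// ler_peMl// ler1n.
have [T [xT rT TrT hT tail]] :=
  cutoff_exists x1 Np (addr_ge0 (addr_ge0 (ler0n R 2) C10) C20) xn.
have q0 := damping_ge0 x1; have q1 := damping_le1 x1.
set r := damping x ^+ 4 in rT TrT hT tail.
have r0 : 0 <= r by exact: exprn_ge0.
have r1 : r <= 1 by exact: exprn_ile1.
have t1 : 1 <= T.+1%:R :> R by rewrite ler1n.
have t2 : T%:R <= T.+1%:R ^+ 2 :> R.
  by rewrite expr2 (@le_trans _ _ T.+1%:R) ?ler_nat// ler_peMr.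
have t3 : 1 <= T.+1%:R ^+ 2 :> R by rewrite exprn_ege1.
have sT : Num.sqrt T%:R <= T.+1%:R ^+ 2 :> R.
  have : Num.sqrt T%:R <= Num.sqrt (T.+1%:R ^+ 2) :> R by rewrite ler_sqrt ?exprn_ge0.
  by rewrite sqrtr_sqr ger0_norm// => h; rewrite (le_trans h)// expr2 ler_peMr.
have bdE : `|sum_err a b c T| <= (2 + C1 + C2) * T.+1%:R ^+ 2.
  exact: abs_le_of_sqr (sqrtr_ge0 _) e11 C10 C20 sT t3 (hC1 T).
have bdd : `|count_diff a b T| <= (2 + C1 + C2) * T.+1%:R ^+ 2.
  by rewrite addrAC; exact: abs_le_of_sqr (ler0n _ _) e21 C20 C10 t2 t3 (dsq _ _ hC2 T).
have rN : (1 - r) * N%:R <= 1 by exact: damping4_short_window.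
have N3 : 0 < N%:R ^+ 3 :> R by rewrite exprn_gt0// ltr0n.
have main := spectral_inequality r0 r1 rN c0 x0 N3 a01 b01 rT TrT (hT _ bdE) (hT _ bdd) tail.
have low := diagonal_sum_ge a0 b0 usq zp xT incr.
rewrite -/xn -/x -/r zE in low.
have sqx : Num.sqrt x = 4 * (k%:R * N%:R).
  rewrite xE (_ : 16 * _ = (4 * (k%:R * N%:R)) ^+ 2); last by ring.
  by rewrite sqrtr_sqr ger0_norm// !mulr_ge0.
have PE := energy_pointwise T.+1 x1 (ltW e10) C10 hC1; rewrite sqx in PE.
have Pd := energy_average T.+1 x1 (ltW e20) C20 hC2.
rewrite -[in leRHS]addrA in main.
apply: (parameters_absurd n1 k1 C20 xE hn (diagonal_term_ge (ler0n _ _) hk low)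
  (main_term_le (ltW c0) xE x1 (sqnorm1_le T.+1 x1))
  (sum_err_terms_le n1 xE N2x2 he1 (energy_ge0 T.+1 _ x1)
     (sqnorm_le_energy T.+1 _ x1) (sqnorm_nat_le_energy T.+1 _ x1) PE)
  (count_diff_terms_le x1 xE N2x2 he2 (energy_ge0 T.+1 _ x1)
     (sqnorm_le_energy T.+1 _ x1) (sqnorm_nat_le_energy T.+1 _ x1) Pd)
  main).
Qed.

(** * Counting functions as sums of indicators *)

Lemma card_fset_set_sum (T : choiceType) (S : set T) (s : seq T) :
  finite_set S -> uniq s -> (forall x, S x -> x \in s) ->
  #|` fset_set S|%N = (\sum_(x <- s) (x \in S))%N.
Proof.
move=> fS us Ss; rewrite -sum1_size.
rewrite (perm_big [seq x <- s | x \in S]) /=; last first.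
  apply: uniq_perm; rewrite ?fset_uniq ?filter_uniq// => x.
  rewrite (in_fset_set fS) mem_filter; case: (boolP (x \in S)) => //= xS.
  by rewrite Ss//; rewrite inE in xS.
by rewrite big_filter big_mkcond; apply: eq_bigr => x _; case: (x \in S).
Qed.

Lemma countf_psum (R : rcfType) (A : set nat) n :
  (countf A n)%:R = psum (\1_A : nat -> R) n.
Proof.
rewrite /countf (@card_fset_set_sum _ _ (iota 0 n.+1))//.
- rewrite natr_sum -[iota _ _]/(index_iota 0 n.+1) big_mkord /psum.
  apply: eq_bigr => i _; rewrite indicE; congr (_ %:R).
  suff -> : (nat_of_ord i \in below A n) = (nat_of_ord i \in A) by [].
  by apply/idP/idP; rewrite !inE /below /=; [case | split => //; rewrite -ltnS].
- exact: finite_below.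
- exact: iota_uniq.
- by move=> x [_ xn]; rewrite mem_iota.
Qed.

(** Summing the convolution up to [n] by its first index groups the pairs
    counted by [sumf] in the same way. *)
Lemma sumf_psum (R : rcfType) (A B : set nat) n :
  (sumf A B n)%:R = psum (convolution (\1_A) (\1_B : nat -> R)) n.
Proof.
rewrite psum_convolution /sumf.
pose s := [seq (i, j) | i <- iota 0 n.+1, j <- iota 0 n.+1].
rewrite (@card_fset_set_sum _ _ s); last first.
- move=> [i j] [_ _ /= ij]; apply/allpairsP; exists (i, j); rewrite !mem_iota /=.
  by split => //; lia.
- by apply: allpairs_uniq; rewrite ?iota_uniq// => -[? ?] [? ?] _ _ [-> ->].
- exact: finite_pairs_below.
rewrite big_allpairs natr_sum -[iota _ _]/(index_iota 0 n.+1) big_mkord.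
apply: eq_bigr => i _; rewrite natr_sum big_mkord.
have ni : ((n - i).+1 <= n.+1)%N by rewrite ltnS leq_subr.
rewrite /psum (big_ord_widen _ (\1_B : nat -> R) ni) [X in _ * X]big_mkcond mulr_sumr.
apply: eq_bigr => j _ /=.
have -> : ((nat_of_ord i, nat_of_ord j) \in pairs_below A B n) =
    [&& nat_of_ord i \in A, nat_of_ord j \in B & (j < (n - i).+1)%N].
  apply/idP/idP.
    rewrite inE => -[/= Ai Bj ij]; apply/and3P; split; rewrite ?inE//.
    by rewrite ltnS; lia.
  move=> /and3P[]; rewrite !inE => Ai Bj ij; split => //=.
  by have := ltn_ord i; move: ij; lia.
rewrite !indicE; case: (_ \in A) => /=; last by rewrite mul0r.
by case: (_ < _)%N; rewrite ?andbT ?andbF ?mulr0// mul1r.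
Qed.

Lemma enum_ge (a : nat -> nat) i : {homo a : i j / (i < j)%N} -> (i <= a i)%N.
Proof.
by move=> ha; elim: i => [//|i IH]; apply: leq_ltn_trans IH _; exact: ha.
Qed.

(** Since [i <= a i], only the first [y + 1] terms of the enumeration can be at
    most [y]. *)
Lemma psum_enum (R : rcfType) (A : set nat) (a : nat -> nat) (n y : nat) :
  enumerates A a -> (n <= y)%N ->
  psum (\1_A : nat -> R) n = \sum_(i < y.+1) (a i <= n)%N%:R.
Proof.
move=> [ha aA] ny.
have ainj : injective a.
  move=> i j; case: (ltngtP i j) => // /ha; rewrite ltn_neqAle => /andP[/eqP].
    by move=> ne _ e; case: ne.
  by move=> ne _ e; case: ne.
have E (m : 'I_n.+1) : \1_A (m : nat) = \sum_(i < y.+1) (a i == m)%:R :> R.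
  rewrite indicE; case: (boolP (_ \in A)) => mA.
    rewrite inE -aA in mA; case: mA => i _ im.
    have iy : (i < y.+1)%N.
      by rewrite ltnS (leq_trans (enum_ge i ha))// im -ltnS (leq_trans (ltn_ord m)).
    rewrite (bigD1 (Ordinal iy))//= im eqxx big1 ?addr0// => j ji.
    rewrite -im (inj_eq ainj); case: eqVneq => // ji'.
    by move: ji; rewrite -val_eqE /= ji' eqxx.
  rewrite big1// => i _; case: eqVneq => // aim; case/negP: mA.
  by rewrite inE -aA -aim; exists i.
rewrite /psum (eq_bigr _ (fun m _ => E m)) exchange_big /=; apply: eq_bigr => i _.
case: leqP => ain; last first.
  by rewrite big1// => m _; case: eqVneq => // aim; move: ain; rewrite aim ltnNge -ltnS ltn_ord.
rewrite (bigD1 (Ordinal (ain : (a i < n.+1)%N)))//= eqxx big1 ?addr0// => m mi.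
by case: eqVneq => // aim; move: mi; rewrite -val_eqE /= aim eqxx.
Qed.

(** A summand is 1 when [n] separates [p] from [q] and 0 otherwise, and there are
    [`|p - q|] separating integers in all. *)
Lemma sum_indicator_between (R : realDomainType) (p q m : nat) :
  \sum_(n < m) `|(p <= n)%N%:R - (q <= n)%N%:R| <= `|p%:R - q%:R| :> R.
Proof.
wlog pq : p q / (p <= q)%N.
  move=> H; case/orP: (leq_total p q) => [/H//|/H].
  by rewrite distrC; under eq_bigr => n _ do rewrite distrC.
have cnt t : \sum_(n < m) (t <= n)%N%:R = (m - t)%N%:R :> R.
  elim: m => [|m IH]; first by rewrite big_ord0.
  rewrite big_ord_recr /= IH -natrD; congr (_ %:R).
  by case: leqP => ?; lia.
rewrite (eq_bigr (fun n : 'I_m => (p <= n)%N%:R - (q <= n)%N%:R)); last first.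
  move=> n _; rewrite ger0_norm// subr_ge0 ler_nat.
  by case: (leqP q n) => // qn; rewrite (leq_trans pq qn).
rewrite sumrB !cnt distrC ger0_norm ?subr_ge0 ?ler_nat//.
rewrite lerBlDr -natrB// -natrD ler_nat; lia.
Qed.

(** * The difference of the counting functions *)

Lemma sum_initial_le (R : realDomainType) (t : nat -> R) (i0 m : nat) :
  (forall i, 0 <= t i) ->
  \sum_(i < m) (if (i < i0)%N then t i else 0) <= \sum_(i < i0) t i.
Proof.
move=> t0; have mi : (i0 <= m + i0)%N by exact: leq_addl.
rewrite (big_ord_widen _ t mi) [leRHS]big_mkcond.
rewrite (big_ord_widen _ (fun i => if (i < i0)%N then t i else 0) (leq_addr i0 m)).
by rewrite [leLHS]big_mkcond; apply: ler_sum => i _; do 2 case: ifP.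
Qed.

(** The difference at [n] is at most the number of indices [i] for which [n]
    separates [a i] from [b i]. After exchanging the sums an index contributes
    at most [`|a i - b i|], and nothing when both terms exceed [y]. *)
Lemma sum_abs_count_diff_le (R : realType) (A B : set nat) (a b : nat -> nat) (y i0 : nat) (t : R) :
  enumerates A a -> enumerates B b -> 0 <= t ->
  (forall i, (i0 <= i)%N -> (a i <= y)%N || (b i <= y)%N ->
     `|(a i)%:R - (b i)%:R| <= t) ->
  \sum_(n < y.+1) `|count_diff (\1_A) (\1_B) n| <=
    \sum_(i < i0) `|(a i)%:R - (b i)%:R| + t * (psum (\1_A) y + psum (\1_B) y).
Proof.
move=> ea eb t0 ht.
have dE (n : 'I_y.+1) : `|count_diff (\1_A) (\1_B) n| <=
    \sum_(i < y.+1) `|(a i <= n)%N%:R - (b i <= n)%N%:R| :> R.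
  have ny : (n <= y)%N by rewrite -ltnS.
  rewrite /count_diff sumrB -/(psum (\1_A) n) -/(psum (\1_B) n).
  by rewrite (psum_enum R ea ny) (psum_enum R eb ny) -sumrB ler_norm_sum.
apply: (le_trans (ler_sum _ (fun n _ => dE n))); rewrite exchange_big /=.
rewrite (psum_enum R ea (leqnn y)) (psum_enum R eb (leqnn y)) -big_split mulr_sumr /=.
have init := @sum_initial_le R (fun i => `|(a i)%:R - (b i)%:R|) i0 y.+1
  (fun=> normr_ge0 _).
apply: le_trans (lerD init (lexx _)).
rewrite -big_split /=; apply: ler_sum => i _.
have s1 := sum_indicator_between R (a i) (b i) y.+1.
case: (ltnP i i0) => ii0.
  by rewrite (le_trans s1)// lerDl mulr_ge0.
rewrite add0r; have [ci|] := boolP ((a i <= y)%N || (b i <= y)%N).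
  rewrite (le_trans s1)// (le_trans (ht _ ii0 ci))// ler_peMr// -natrD ler1n.
  by move: ci; case: (_ <= _)%N; case: (_ <= _)%N.
rewrite negb_or -!ltnNge => /andP[ya yb].
rewrite big1 => [|n _]; first by rewrite mulr_ge0 ?addr_ge0.
by rewrite [(a i <= n)%N]leqNgt [(b i <= n)%N]leqNgt (leq_trans (ltn_ord n) ya)
  (leq_trans (ltn_ord n) yb) subrr normr0.
Qed.

Lemma powR_quarter (R : realType) (n : nat) : (n%:R `^ (1 / 4)) ^+ 2 = Num.sqrt n%:R :> R.
Proof.
rewrite -powR12_sqrt// -powR_mulrn ?powR_ge0// -powRrM; congr (_ `^ _). by field.
Qed.

(** The square of [n ^ (1/4)] is [sqrt n]; the finitely many indices below the
    threshold go into the constant. *)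
Lemma sum_err_sq_le (R : realType) (A B : set nat) (c : R) :
  (fun n : nat => (sumf A B n)%:R : R) =
      (fun n : nat => c * n%:R) +o_\oo (fun n : nat => n%:R `^ (1 / 4) : R) ->
  forall eps, 0 < eps -> exists C, forall n,
    sum_err (\1_A) (\1_B) c n ^+ 2 <= eps * Num.sqrt n%:R + C.
Proof.
move=> /eqaddoP hR eps eps0.
have d0 : 0 < Num.sqrt (eps / 2) by rewrite sqrtr_gt0 divr_gt0.
have [N _ HN] := hR _ d0.
exists (2 * c ^+ 2 + \sum_(i < N) sum_err (\1_A) (\1_B) c i ^+ 2) => n.
have sum0 m : 0 <= \sum_(i < m) sum_err (\1_A) (\1_B) c i ^+ 2 by apply: sumr_ge0 => i _; exact: sqr_ge0.
have c2 := sqr_ge0 c; have sn := sqrtr_ge0 (n%:R : R).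
case: (ltnP n N) => nN.
  rewrite (bigD1 (Ordinal nN))//=.
  have : 0 <= eps * Num.sqrt n%:R by rewrite mulr_ge0// ltW.
  have : 0 <= \sum_(i < N | i != Ordinal nN) sum_err (\1_A) (\1_B) c i ^+ 2.
    by apply: sumr_ge0 => i _; exact: sqr_ge0.
  lra.
have {HN} := HN n nN; rewrite /= !fctE.
have -> : sum_err (\1_A) (\1_B) c n = ((sumf A B n)%:R - c * n%:R) - c.
  by rewrite /sum_err -/(psum _ n) sumf_psum -natr1; move: (psum _ n) => p; ring.
rewrite (ger0_norm (powR_ge0 _ _)).
set t := _ - _ => ht.
have h2 : t ^+ 2 <= eps / 2 * Num.sqrt n%:R.
  rewrite -[t ^+ 2]real_normK ?num_real// -powR_quarter -[eps / 2]sqr_sqrtr; last lra.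
  by rewrite -exprMn lerXn2r ?nnegrE ?mulr_ge0 ?powR_ge0// ltW.
have := sum0 N; have := sqr_ge0 (t + c); nra.
Qed.

(** As in [psum_increment], the square of the sum is four times a product at
    most [R(2 n)], plus the square of the difference. *)
Lemma psum_sqrt_le (R : realType) (A B : set nat) (c C : R) : 0 < c ->
  (forall eps, 0 < eps -> exists C, forall n,
    sum_err (\1_A) (\1_B) c n ^+ 2 <= eps * Num.sqrt n%:R + C) ->
  (forall n : nat, (1 <= n)%N -> count_diff (\1_A) (\1_B) n ^+ 2 <= C * n%:R) ->
  exists2 K : R, 0 <= K & forall n : nat, (1 <= n)%N ->
    psum (\1_A) n + psum (\1_B) n <= K * Num.sqrt n%:R.
Proof.
move=> c0 hE hd; have [C1 hC1] := hE 1 ltr01.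
have C10 : 0 <= C1.
  by have := hC1 0%N; rewrite sqrtr0 mulr0 add0r; apply: le_trans; exact: sqr_ge0.
have C0 : 0 <= C.
  by have := hd 1%N isT; rewrite mulr1; apply: le_trans; exact: sqr_ge0.
pose K2 := 4 * (3 * c + 3 + C1) + C.
have K20 : 0 <= K2 by rewrite /K2; lra.
exists (Num.sqrt K2) => [|n n1]; first exact: sqrtr_ge0.
have ind0 (S : set nat) i : 0 <= \1_S i :> R by rewrite indicE.
have n1R : 1 <= n%:R :> R by rewrite ler1n.
rewrite -sqrtrM//.
have p0 : 0 <= psum (\1_A) n + psum (\1_B) n :> R by rewrite addr_ge0 ?psum_ge0.
rewrite -[leLHS]ger0_norm// -sqrtr_sqr ler_sqrt; last by rewrite mulr_ge0.
have := psum_convolution_ge n (ind0 A) (ind0 B).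
have -> : psum (convolution (\1_A) (\1_B)) n.*2 = c * (n.*2.+1)%:R + sum_err (\1_A) (\1_B) c n.*2 :> R.
  by rewrite /sum_err -/(psum _ _); move: (psum _ _) => p; ring.
have s2 : Num.sqrt n.*2%:R <= 2 * n%:R :> R.
  rewrite -[leRHS]ger0_norm ?mulr_ge0// -sqrtr_sqr ler_sqrt ?exprn_ge0 ?mulr_ge0//.
  by rewrite -mul2n natrM expr2 ler_peMr ?mulr_ge0//; lra.
have := abs_le_sqr1 (sum_err (\1_A) (\1_B) c n.*2); rewrite ler_norml => /andP[_].
have := hC1 n.*2; rewrite mul1r.
have := hd n n1; rewrite /count_diff sumrB -/(psum (\1_A) n) -/(psum (\1_B) n).
have n2 : n.*2%:R = 2 * n%:R :> R by rewrite -mul2n natrM.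
rewrite -[_.*2.+1%:R]natr1 [X in c * (X + 1)]n2.
have : C1 <= C1 * n%:R by rewrite ler_peMr.
have : c <= c * n%:R by rewrite ler_peMr// ltW.
move: (psum (\1_A) n) (psum (\1_B) n) (sum_err _ _ _ _) (Num.sqrt _) s2 => p q e sq s2.
rewrite /K2; move: (n%:R) n1R s2 => N N1 s2.
move=> h1 h2 h3 h4 h5 h6.
have -> : (p + q) ^+ 2 = 4 * (p * q) + (p - q) ^+ 2 by ring.
lra.
Qed.

Lemma count_diff_countf (R : rcfType) (A B : set nat) n :
  count_diff (R := R) (\1_A) (\1_B) n = (countf A n)%:R - (countf B n)%:R :> R.
Proof. by rewrite !countf_psum /count_diff sumrB. Qed.

(** By (1) each of the [O(sqrt y)] relevant indices contributes at most a small
    multiple of [y ^ (1/2 - alpha)] to the sum of the absolute differences, and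
    by (2) each difference is [O(y ^ alpha)]; the exponents add up to 1. *)
Lemma count_diff_sq_sum_le (R : realType) (alpha C K : R) (A B : set nat) (a b : nat -> nat) :
  0 <= alpha <= 1 / 4 -> enumerates A a -> enumerates B b ->
  (fun i : nat => (a i)%:R - (b i)%:R : R) =o_\oo
         (fun i : nat => (a i)%:R `^ (1 / 2 - alpha) : R) ->
  (forall n : nat, (1 <= n)%N -> `|count_diff (R := R) (\1_A) (\1_B) n| <= C * n%:R `^ alpha) ->
  0 <= K ->
  (forall n : nat, (1 <= n)%N ->
     psum (R := R) (\1_A) n + psum (R := R) (\1_B) n <= K * Num.sqrt n%:R) ->
  forall eps, 0 < eps -> exists C', forall y : nat,
    \sum_(n < y.+1) count_diff (R := R) (\1_A) (\1_B) n ^+ 2 <= eps * y%:R + C'.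
Proof.
move=> /andP[al0 al4] eA eB /eqoP hab hAB K0 hU eps eps0.
set beta := 1 / 2 - alpha in hab.
have be0 : 0 <= beta by rewrite /beta; lra.
have C0 : 0 <= C by have := hAB 1%N isT; rewrite powR1 mulr1; apply: le_trans.
pose C1 := C + 1; have C10 : 1 <= C1 by rewrite /C1; lra.
have C1p : 0 <= C1 by lra.
have CK : 0 <= C1 * K by rewrite mulr_ge0.
pose delta := Num.min (1 / 2) (eps / (4 * (C1 * K + 1))).
have de0 : 0 < delta by rewrite lt_min !divr_gt0//; lra.
have de2 : delta <= 1 / 2 by rewrite ge_min lexx.
have deK : 2 * C1 * K * delta <= eps / 2.
  have : delta <= eps / (4 * (C1 * K + 1)) by rewrite ge_min lexx orbT.
  rewrite ler_pdivlMr; last lra.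
  have : 0 <= delta by lra.
  lra.
have [i1 _ Hi1] := hab _ de0.
pose i0 := maxn i1 1.
pose D0 := \sum_(i < i0) `|(a i)%:R - (b i)%:R| : R.
have D00 : 0 <= D0 by exact: sumr_ge0.
have d0 : `|count_diff (R := R) (\1_A) (\1_B) 0%N| <= 1 :> R.
  rewrite /count_diff big_ord1 !indicE; case: (_ \in A); case: (_ \in B);
    by rewrite /= ?subrr ?subr0 ?sub0r ?normrN ?normr1 ?normr0.
exists (1 + (C1 * D0) ^+ 2 / (2 * eps)) => -[|y].
  rewrite big_ord1 mulr0 add0r -[leLHS]real_normK ?num_real//.
  have : 0 <= (C1 * D0) ^+ 2 / (2 * eps) by rewrite divr_ge0 ?sqr_ge0//; lra.
  have := normr_ge0 (count_diff (R := R) (\1_A) (\1_B) 0%N : R); nra.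
set Y : R := y.+1%:R; have Y1 : 1 <= Y by rewrite ler1n.
have ya1 : 1 <= Y `^ alpha by rewrite -(powRr0 Y) ler_powR.
have dY (n : 'I_y.+2) : `|count_diff (R := R) (\1_A) (\1_B) n| <= C1 * Y `^ alpha.
  have [n0|n0] := posnP (nat_of_ord n).
    rewrite n0 (le_trans d0)// (le_trans C10)// ler_peMr//; lra.
  rewrite (le_trans (hAB _ n0))//.
  have : n%:R `^ alpha <= Y `^ alpha.
    by rewrite ge0_ler_powR ?nnegrE// ler_nat -ltnS.
  have := powR_ge0 (n%:R : R) alpha; rewrite /C1; nra.
pose t := delta * (2 * Y) `^ beta.
have t0 : 0 <= t by rewrite mulr_ge0 ?powR_ge0// ltW.
have ht i : (i0 <= i)%N -> (a i <= y.+1)%N || (b i <= y.+1)%N ->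
    `|(a i)%:R - (b i)%:R| <= t.
  rewrite geq_max => /andP[i1i i_gt0] hy.
  have hi : `|(a i)%:R - (b i)%:R| <= delta * (a i)%:R `^ beta.
    by have := Hi1 i i1i; rewrite /= [X in _ * X]ger0_norm ?powR_ge0.
  rewrite (le_trans hi)// ler_wpM2l//; first exact: ltW.
  have ai1 : 1 <= (a i)%:R :> R.
    by rewrite ler1n (leq_trans i_gt0)// enum_ge//; case: eA.
  rewrite ge0_ler_powR ?nnegrE//; first by rewrite mulr_ge0//; lra.
  case/orP: hy => hy.
    have : (a i)%:R <= Y by rewrite ler_nat.
    lra.
  have biY : (b i)%:R <= Y by rewrite ler_nat.
  (* If only [b i <= y] is known, [`|a i - b i| <= a i / 2] still bounds [a i]
     by [2 y]. *)
  have aib : (a i)%:R `^ beta <= (a i)%:R.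
    rewrite -[leRHS]powRr1; last lra.
    by rewrite ler_powR//; rewrite /beta; lra.
  move: hi; rewrite ler_norml => /andP[_ hi].
  have : delta * (a i)%:R `^ beta <= 1 / 2 * (a i)%:R.
    by rewrite ler_pM ?powR_ge0// ltW.
  lra.
have S1 := sum_abs_count_diff_le eA eB t0 ht; rewrite -/D0 in S1.
have S2 : \sum_(n < y.+2) count_diff (R := R) (\1_A) (\1_B) n ^+ 2 <=
    C1 * Y `^ alpha * (D0 + t * (K * Num.sqrt Y)).
  apply: (@le_trans _ _ (C1 * Y `^ alpha * \sum_(n < y.+2) `|count_diff (R := R) (\1_A) (\1_B) n|)).
    rewrite mulr_sumr; apply: ler_sum => n _.
    by rewrite -[leLHS]real_normK ?num_real// expr2 ler_wpM2r.
  rewrite ler_wpM2l ?mulr_ge0 ?powR_ge0//.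
  by rewrite (le_trans S1)// lerD2l ler_wpM2l// hU.
apply: (le_trans S2).
have Y0 : Y != 0 by rewrite gt_eqF//; lra.
have sqY : Num.sqrt Y ^+ 2 = Y by rewrite sqr_sqrtr//; lra.
have yab : Y `^ alpha * Y `^ beta * Num.sqrt Y = Y.
  rewrite -powRD ?Y0 ?implybT// (_ : alpha + beta = 2^-1); last by rewrite /beta; field.
  by rewrite powR12_sqrt -?expr2//; lra.
have t2 : t <= delta * (2 * Y `^ beta).
  rewrite /t ler_wpM2l//; first exact: ltW.
  rewrite powRM//.
  rewrite ler_wpM2r ?powR_ge0// -[leRHS]powRr1// ler_powR//; first lra.
  by rewrite /beta; lra.
have yas : Y `^ alpha <= Num.sqrt Y.
  rewrite -powR12_sqrt; last lra.
  by rewrite ler_powR//; lra.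
have s0 := sqrtr_ge0 Y.
have p1 : C1 * Y `^ alpha * (t * (K * Num.sqrt Y)) <= eps / 2 * Y.
  apply: (@le_trans _ _ (C1 * Y `^ alpha * (delta * (2 * Y `^ beta) * (K * Num.sqrt Y)))).
    rewrite ler_wpM2l ?mulr_ge0 ?powR_ge0//.
    by rewrite ler_wpM2r// mulr_ge0.
  rewrite (_ : _ * _ = 2 * C1 * K * delta * (Y `^ alpha * Y `^ beta * Num.sqrt Y)); last ring.
  by rewrite yab ler_wpM2r//; lra.
have p2 : C1 * Y `^ alpha * D0 <= C1 * D0 * Num.sqrt Y.
  by rewrite mulrAC ler_wpM2l// mulr_ge0//; lra.
have p3 : C1 * D0 * Num.sqrt Y <= eps / 2 * Y + (C1 * D0) ^+ 2 / (2 * eps).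
  rewrite -{2}sqY; set m := C1 * D0; set s := Num.sqrt Y.
  rewrite -subr_ge0 (_ : _ - _ = (eps * s - m) ^+ 2 / (2 * eps)); last by field; lra.
  by rewrite divr_ge0 ?sqr_ge0//; lra.
rewrite mulrDr; lra.
Qed.

Theorem theorem1 (R : realType) (alpha : R) (A B : set nat) (a b : nat -> nat)
  (halpha : 0 <= alpha <= 1 / 4)
  (infA : infinite_set A) (infB : infinite_set B)
  (enumA : enumerates A a) (enumB : enumerates B b)
  (hab : (fun i : nat => (a i)%:R - (b i)%:R : R) =o_\oo
         (fun i : nat => (a i)%:R `^ (1 / 2 - alpha) : R))
  (hAB : exists C : R, forall n : nat, (1 <= n)%N ->
         `|(countf A n)%:R - (countf B n)%:R| <= C * n%:R `^ alpha) :
  ~ exists2 c : R, 0 < c &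
      (fun n : nat => (sumf A B n)%:R : R) =
      (fun n : nat => c * n%:R) +o_\oo (fun n : nat => n%:R `^ (1 / 4) : R).
Proof.
move=> [c c0 /sum_err_sq_le hE]; have [C hC] := hAB.
have {}hC n : (1 <= n)%N -> `|count_diff (R := R) (\1_A) (\1_B) n| <= C * n%:R `^ alpha.
  by rewrite count_diff_countf; exact: hC.
have hd n : (1 <= n)%N -> count_diff (R := R) (\1_A) (\1_B) n ^+ 2 <= C ^+ 2 * n%:R.
  move=> n1; have n1R : 1 <= n%:R :> R by rewrite ler1n.
  rewrite -[leLHS]real_normK ?num_real//.
  apply: (@le_trans _ _ ((C * n%:R `^ alpha) ^+ 2)).
    by rewrite lerXn2r ?nnegrE ?hC// (le_trans _ (hC n n1)).
  rewrite exprMn ler_wpM2l ?sqr_ge0// -powR_mulrn ?powR_ge0// -powRrM.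
  rewrite -[leRHS]powRr1// ler_powR//.
  by case/andP: halpha; lra.
have [K K0 hK] := psum_sqrt_le c0 hE hd.
have ind (S : set nat) n : \1_S n = 0 :> R \/ \1_S n = 1 :> R.
  by rewrite indicE; case: (_ \in S); [right | left].
apply: (no_sharp_asymptotic (ind A) (ind B) c0 hE).
exact: count_diff_sq_sum_le halpha enumA enumB hab hC K0 hK.
Qed.
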